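(* Let $\mathcal{H}$ be an arbitrary family of finite $k$-partite $k$-hypergraphs of the form $H=(E;X_1,\dots,X_k)$ with $E\subseteq\prod_{i=1}^kX_i$ and $X_i$ finite. Assume that any ultraproduct $\widetilde H=(\widetilde E;\widetilde X_1,\dots,\widetilde X_k)$ of the hypergraphs from $\mathcal{H}$ satisfies the following: for every $\varepsilon>0$ there exist, for each $1\le t\le k$, finitely many pairwise-disjoint sets $A^t_i\in\mathcal{B}_{\widetilde X_t}$, $1\le i\le n_t\in\mathbb{N}$, so that each $A^t_i$ is perfect for $\widetilde E$ viewed as a binary relation on $\widetilde X_t\times\left(\prod_{s\in[k]\setminus\{t\}}\widetilde X_s\right)$ and $\mu_{\widetilde X_t}\left(\bigcup_{i=1}^{n_t}A^t_i\right)\ge1-\varepsilon\mu_{\widetilde X_t}(A^t_1)$. Then $\mathcal{H}$ satisfies strong stable regularity. Moreover, if the sets $A^t_i$ can always be chosen in $\mathcal{B}^{\widetilde E}_{\widetilde X_t}$, then $\mathcal{H}$ satisfies definable strong stable regularity.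
   Context: A finite $k$-partite $k$-hypergraph is $H=(E;X_1,\dots,X_k)$ with $X_i$ finite nonempty sets, $E\subseteq\prod_iX_i$. Strong stable regularity: for every $\varepsilon>0$ and every $f:\mathbb{N}\to(0,1]$ there is $N=N(f,\varepsilon)$ so that for any $H\in\mathcal{H}$ there exist $N'\le N$ and partitions $X_i=\bigsqcup_{0\le t<N'}A_{i,t}$ ($1\le i\le k$) with (a) $|A_{i,0}|\le\varepsilon|A_{i,1}|$ for all $i$; (b) for any $1\le t_1,\dots,t_k<N'$, $\frac{|E\cap(A_{1,t_1}\times\dots\times A_{k,t_k})|}{|A_{1,t_1}\times\dots\times A_{k,t_k}|}\in[0,f(N'))\cup(1-f(N'),1]$ (only required when the denominator is nonzero; parts may be empty). Definable strong stable regularity: moreover, the sets $A_{i,t}$ can be chosen in $\mathcal{F}^{E,N}_{X_i}$, the collection of all intersections of at most $N$ sets each of which is a fiber $E_b\subseteq X_i$ of $E$ at some $b\in\prod_{j\ne i}X_j$, or the complement of such a fiber. Ultraproducts: given $H_n=(E_n;X_{1,n},\dots,X_{k,n})\in\mathcal{H}$, $n\in\mathbb{N}$, and an ultrafilter $\mathcal{U}$ on $\mathbb{N}$, let $\widetilde X_i=\prod_nX_{i,n}/\mathcal{U}$, $\widetilde E=\prod_nE_n/\mathcal{U}$. For $S$ any finite product of the $X_i$'s, internal subsets of $\widetilde S$ are those of the form $\prod_nA_n/\mathcal{U}$ with $A_n\subseteq S_n$; $\mathcal{B}_{\widetilde S}$ is the $\sigma$-algebra they generate and $\mu_{\widetilde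 S}$ the unique countably additive probability measure on it with $\mu_{\widetilde S}(\prod_nA_n/\mathcal{U})=\lim_{n\to\mathcal{U}}|A_n|/|S_n|$. $\mathcal{B}^{\widetilde E}_{\widetilde X_t}$ is the $\sigma$-subalgebra of $\mathcal{B}_{\widetilde X_t}$ generated by the fibers $\widetilde E_b\subseteq\widetilde X_t$, $b\in\prod_{s\ne t}\widetilde X_s$. A set $A\in\mathcal{B}_{\widetilde X_t}$ is perfect for $\widetilde E$ viewed as a binary relation on $\widetilde X_t\times\prod_{s\ne t}\widetilde X_s$ if for almost every $b\in\prod_{s\ne t}\widetilde X_s$, $\mu(A\cap\widetilde E_b)=0$ or $\mu(A\setminus\widetilde E_b)=0$.
   Formalization: In definable strong stable regularity only the sets A_{i,t} with t ≥ 1 are required to lie in F^{E,N}_{X_i}; the exceptional set A_{i,0} is just the complement of their union, since requiring A_{i,0} in F^{E,N}_{X_i} as well makes the ''moreover'' claim false. *)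

(* Defs.v *)
From HB Require Import structures.
From mathcomp Require Import all_boot all_order all_algebra generic_quotient.
From mathcomp Require Import all_classical all_reals all_analysis.

Set Implicit Arguments.
Unset Strict Implicit.
Unset Printing Implicit Defensive.

Import Order.TTheory GRing.Theory Num.Theory.
Import numFieldNormedType.Exports.

Local Open Scope classical_set_scope.
Local Open Scope ring_scope.
Local Open Scope quotient_scope.

(* Nonemptiness is a proposition, not a chosen point: a point is needed only  *)
(* to make ultraproducts instances of pointedType.                            *)
Record neFinType := NeFinType {
  neFin_sort :> finType;
  neFin_gt0 : (0 < #|{: neFin_sort}|)%N }.

Definition neFin_point (T : neFinType) : T :=
  enum_val (Ordinal (neFin_gt0 T)).

Section FiniteProduct.
Variables (I : finType) (T : I -> neFinType).

Lemma dffun_gt0 : (0 < #|{: {dffun forall i : I, T i}}|)%N.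
Proof. by apply/card_gt0P; exists [ffun i => neFin_point (T i)]. Qed.

Definition neProd : neFinType := NeFinType dffun_gt0.

End FiniteProduct.

Section Hypergraphs.
Variable k : nat.

Record hypergraph := Hypergraph {
  part : 'I_k -> neFinType;
  edges : {set {dffun forall i : 'I_k, part i}} }.

Implicit Types (G : hypergraph) (i t : 'I_k).

Definition vertices G : neFinType := neProd (part G).

Definition coprod G t : neFinType :=
  neProd (fun s : {s : 'I_k | s != t} => part G (val s)).

(* The two projections identifying the full product of the parts with the     *)
(* binary product (part G t) x (coprod G t).                                  *)
Definition vproj G t (e : vertices G) : part G t :=
  (e : {dffun forall i : 'I_k, part G i}) t.

Definition vrestr G t (e : vertices G) : coprod G t :=
  [ffun s : {s : 'I_k | s != t} =>
     (e : {dffun forall i : 'I_k, part G i}) (val s)].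

Definition fiber G t (b : coprod G t) : {set part G t} :=
  [set vproj t e | e in edges G & vrestr t e == b]%SET.

(* The empty intersection, allowed here, is the whole part.                   *)
Definition fiber_intersection G t (N : nat) (A : {set part G t}) : Prop :=
  exists s : seq {set part G t},
    [/\ (size s <= N)%N,
        (forall B, B \in s ->
           exists b : coprod G t, B = fiber b \/ B = (~: fiber b)%SET) &
        A = (\bigcap_(B <- s) B)%SET].

Section Regularity.
Variable R : realType.

Definition density G (B : {set {dffun forall i, part G i}}) : R :=
  #|edges G :&: B|%:R / #|B|%:R.

(* Only the values A i t with t < N' matter. The condition 1 < N' is what     *)
(* makes A i 1 one of the parts.                                              *)
Definition regular_partition G (eps : R) (f : nat -> R) (N' : nat)
    (A : forall i, nat -> {set part G i}) : Prop :=
  [/\ (1 < N')%N,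
      (forall i x, exists2 t : nat, (t < N')%N & x \in A i t),
      (forall i (t u : nat), (t < N')%N -> (u < N')%N -> t != u ->
         [disjoint A i t & A i u]%B),
      (forall i, #|A i 0%N|%:R <= eps * #|A i 1%N|%:R) &
      forall t : 'I_k -> nat, (forall i, (0 < t i < N')%N) ->
        let B := setXn (fun i => A i (t i)) in
        B != finset.set0 ->
        (density B \in `[0, f N'[) \/ (density B \in `]1 - f N', 1])].

Definition strong_stable_regularity (H : hypergraph -> Prop) : Prop :=
  forall (eps : R) (f : nat -> R), 0 < eps -> (forall n, 0 < f n <= 1) ->
  exists N : nat, forall G, H G ->
  exists (N' : nat) (A : forall i, nat -> {set part G i}),
    (N' <= N)%N /\ regular_partition eps f N' A.

(* The regular parts A i t with 0 < t are intersections of at most N fibers   *)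
(* and complements of fibers. The exceptional part A i 0 is the complement of *)
(* their union, hence a Boolean combination of boundedly many fibers. It is   *)
(* not required to be a single intersection, as this is not achievable: take  *)
(* k = 2 and cut each X_i into three blocks X_i^c, each cut in turn into n    *)
(* classes of sizes 2^(n-1), ..., 2, 1. Let E be the equality of class        *)
(* indices between X_1^c and X_2^c, everything between X_1^c and X_2^d if     *)
(* c > d, and nothing if c < d. As n varies, the classes give perfect         *)
(* decompositions of every ultraproduct. But a small intersection of fibers   *)
(* and complements meets two or more classes in at most one block, so that in *)
(* some block all classes but at most one on either side would lie in regular *)
(* parts, which fails for f decreasing fast enough.                           *)
Definition definable_strong_stable_regularity (H : hypergraph -> Prop) : Prop :=
  forall (eps : R) (f : nat -> R), 0 < eps -> (forall n, 0 < f n <= 1) ->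
  exists N : nat, forall G, H G ->
  exists (N' : nat) (A : forall i, nat -> {set part G i}),
    [/\ (N' <= N)%N, regular_partition eps f N' A &
        forall i (t : nat), (0 < t < N')%N -> fiber_intersection N (A i t)].

End Regularity.
End Hypergraphs.

Section Ultraproduct.
Variables (U : set_system nat) (UU : UltraFilter U).

Section Space.
Variable T : nat -> neFinType.

Definition ultra_eq (x y : {classic forall n, T n}) : bool :=
  `[< \forall n \near U, x n = y n >].

Lemma ultra_eq_refl : reflexive ultra_eq.
Proof. by move=> x; apply/asboolP; near=> n. Unshelve. all: by end_near. Qed.

Lemma ultra_eq_sym : ssrbool.symmetric ultra_eq.
Proof.
by move=> x y; apply/asboolP/asboolP; apply: filterS => n /esym.
Qed.

Lemma ultra_eq_trans : ssrbool.transitive ultra_eq.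
Proof.
move=> y x z /asboolP xy /asboolP yz; apply/asboolP.
by apply: filterS2 xy yz => n ->.
Qed.

Canonical ultra_equiv : equiv_rel {classic forall n, T n} :=
  EquivRel ultra_eq ultra_eq_refl ultra_eq_sym ultra_eq_trans.

Definition ultraproduct : Type := {eq_quot ultra_equiv}.

HB.instance Definition _ := Choice.on ultraproduct.

Definition ultra_class (x : forall n, T n) : ultraproduct :=
  \pi_({eq_quot ultra_equiv}) (x : {classic forall n, T n}).

Definition ultra_repr (x : ultraproduct) : forall n, T n :=
  (repr (x : {eq_quot ultra_equiv}) : {classic forall n, T n}).

HB.instance Definition _ :=
  isPointed.Build ultraproduct (ultra_class (fun n => neFin_point (T n))).

Definition internal_set (A : forall n, {set T n}) : set ultraproduct :=
  [set x | \forall n \near U, ultra_repr x n \in A n].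

Definition internal_sets : set (set ultraproduct) := range internal_set.

(* The ultraproduct with its sigma-algebra generated by the internal sets.    *)
Definition loebType := g_sigma_algebraType internal_sets.

Definition is_loeb_measure (R : realType) (mu : probability loebType R) : Prop :=
  forall A : forall n, {set T n},
    (fun n => (#|A n|%:R / #|{: T n}|%:R : R)%:E) @ U -->
    mu (internal_set A : set loebType).

End Space.

Definition ultra_map (S T : nat -> neFinType) (f : forall n, S n -> T n)
    (x : ultraproduct S) : ultraproduct T :=
  ultra_class (fun n => f n (ultra_repr x n)).

Section UltraHypergraph.
Variables (k : nat) (G : nat -> hypergraph k) (t : 'I_k).

Definition upart := loebType (fun n => part (G n) t).

(* The product of the ultraproducts of the parts other than t, identified     *)
(* with the ultraproduct of their products.                                   *)
Definition ucoprod := loebType (fun n => coprod (G n) t).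

Definition uedges : set (ultraproduct (fun n => vertices (G n))) :=
  @internal_set (fun n => vertices (G n)) (fun n => edges (G n)).

Definition ufiber (b : ucoprod) : set upart :=
  [set ultra_map (fun n => @vproj k (G n) t) e |
    e in uedges `&` [set e | ultra_map (fun n => @vrestr k (G n) t) e = b]].

Definition fiber_sigma_algebra : set (set upart) := <<s range ufiber >>.

Section Perfect.
Variables (R : realType) (mu : probability upart R).
Variable nu : probability ucoprod R.

Definition perfect (A : set upart) : Prop :=
  measurable A /\
  {ae nu, forall b, mu (A `&` ufiber b) = 0%E \/ mu (A `\` ufiber b) = 0%E}.

(* A ord0 is the first of the n.+1 sets.                                      *)
Definition perfect_decomposition (C : set (set upart)) (eps : R) : Prop :=
  exists (n : nat) (A : 'I_n.+1 -> set upart),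
    [/\ (forall i, C (A i)),
        (forall i, perfect (A i)),
        trivIset setT A &
        (1 - eps%:E * mu (A ord0) <= mu (\bigcup_i A i))%E].

End Perfect.
End UltraHypergraph.
End Ultraproduct.

(* The Loeb measures exist and are unique, so that quantifying over all       *)
(* probability measures with the defining property is just naming them.       *)
Definition ultraproducts_perfect (R : realType) (k : nat)
    (H : hypergraph k -> Prop)
    (C : forall (U : set_system nat) (UU : UltraFilter U)
                (G : nat -> hypergraph k) (t : 'I_k), set (set (upart UU G t))) :
    Prop :=
  forall (G : nat -> hypergraph k) (U : set_system nat) (UU : UltraFilter U)
    (mu : forall t : 'I_k, probability (upart UU G t) R)
    (nu : forall t : 'I_k, probability (ucoprod UU G t) R),
    (forall n, H (G n)) ->
    (forall t, is_loeb_measure (mu t)) ->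
    (forall t, is_loeb_measure (nu t)) ->
  forall eps : R, 0 < eps ->
  forall t : 'I_k, perfect_decomposition (mu t) (nu t) (C U UU G t) eps.

(* Main.v *)
From HB Require Import structures.
Require Import Defs.
From mathcomp Require Import all_boot all_order all_algebra generic_quotient.
From mathcomp Require Import all_classical all_reals all_analysis.
From mathcomp Require Import ring lra.

(* The hypothesis about all measurable sets already gives definability. If    *)
(* every bound N fails, the ultraproduct of counterexamples has a perfect     *)
(* decomposition, whose parts are approximated by internal sets. So in many   *)
(* of the finite hypergraphs each X_t is covered, up to a small error, by     *)
(* sets B_j, each with a prediction m_j(y) of membership in the fiber over y  *)
(* that is wrong for few pairs (x, y) with x in B_j. Sample y_1, ..., y_M at  *)
(* random and replace B_j by the set D_j of all x on which m_j is right at    *)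
(* every y_l. This D_j is an intersection of M fibers and complements of      *)
(* fibers, and two such sets are equal or disjoint. It misses little of B_j,  *)
(* and m_j is still accurate on it: a point where m_j errs with probability q *)
(* stays in D_j with probability (1 - q)^M, and q (1 - q)^M <= 1/(M+1).       *)
(* Finally, in a product of such sets, one for each X_t, edge membership      *)
(* rarely changes when a single coordinate is resampled, so the density is    *)
(* near 0 or 1.                                                               *)

Set Implicit Arguments.
Unset Strict Implicit.
Unset Printing Implicit Defensive.

Import Order.TTheory GRing.Theory Num.Theory.
Import numFieldNormedType.Exports.

Local Open Scope ring_scope.

(** * Boxes and sampling *)

(** The compactness argument depends on the order in which quantities are fixed. The ultraproduct
    alone determines the number of parts and a positive lower bound [c] on their measures, so the
    final number of parts [N'], and with it [f N'], is known before any accuracy is chosen.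
    [internal_decomposition] then supplies internal approximations of accuracy [eta] for every
    [eta], with the same number of sets and the same bound.

    Perfectness, a statement about null sets, becomes a finite statement in [perfect_disagreement]:
    for [U]-many [n], membership in the fiber over [y] is predicted on an approximating set by a
    function of [y] alone, up to few errors. Two finite facts finish the proof. [sampling] replaces
    each approximating set by an intersection of fibers and complements without spoiling the
    prediction. [box_homogeneous] says that a set of edges predictable in every direction on a box
    must nearly fill the box or nearly miss it. The Loeb measures are needed as actual objects to
    instantiate the hypothesis, and they come from saturation and Caratheodory extension
    ([loeb_measure_exists]). *)

Section Mix.
Variables (I : finType) (T : I -> finType).
Local Notation V := {dffun forall i : I, T i}.
Implicit Types (S : {set I}) (x y : V).

Definition mix S x y : V := [ffun i => if i \in S then y i else x i].

Lemma mixK S x y : mix S (mix S x y) (mix S y x) = x.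
Proof. by apply/ffunP => i; rewrite !ffunE; case: (i \in S). Qed.

Lemma mix_set0 x y : mix finset.set0 x y = x.
Proof. by apply/ffunP => i; rewrite !ffunE inE. Qed.

Lemma mix_setT x y : mix [set: I]%SET x y = y.
Proof. by apply/ffunP => i; rewrite !ffunE inE. Qed.

Variable D : forall i, {set T i}.
Local Notation W := (setXn D).

Lemma mix_setXn S x y : x \in W -> y \in W -> mix S x y \in W.
Proof.
by move=> /setXnP Wx /setXnP Wy; apply/setXnP => i; rewrite ffunE; case: ifP.
Qed.

(** Swapping the coordinates in [S] between two points is an involution of [W] x [W]. Hence the
    mixture of two independent uniform points of the box is again uniform. *)
Lemma card_mix S (B : {set V}) : B \subset W ->
  (#|[set p in finset.setX W W | mix S p.1 p.2 \in B]| <= #|B| * #|W|)%N.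
Proof.
move=> BW; rewrite -cardsX.
pose h (p : V * V) := (mix S p.1 p.2, mix S p.2 p.1).
have hK : cancel h h by case=> x y; rewrite /h /= !mixK.
rewrite -(card_imset _ (can_inj hK)); apply/subset_leq_card/fintype.subsetP => q.
case/imsetP => -[x y]; rewrite inE finset.in_setX /= => /andP[/andP[Wx Wy] Bm] ->.
by rewrite finset.in_setX Bm mix_setXn.
Qed.

Variables (E : {set V}) (m : I -> pred V) (N : nat).
Hypothesis mE : forall i (x y : V), (forall j, j != i -> x j = y j) -> m i x = m i y.
Hypothesis cardN : forall i, (#|[set v in W | (v \in E) != m i v]| <= N)%N.

(** Induction on [S], one coordinate [i] at a time. The mixtures along [S] and along [i |: S] agree
    off [i], so [m i] makes the same prediction for both. If they differ in membership in [E], then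
    [m i] errs at one of them, and [card_mix] bounds each of these two events by [N * #|W|]
    pairs. *)
Lemma card_mix_neq S :
  (#|[set p in finset.setX W W | (p.1 \in E) != (mix S p.1 p.2 \in E)]|
     <= #|S| * (2 * (N * #|W|)))%N.
Proof.
have [n] := ubnP #|S|; elim: n S => // n IHn S0 ltSn.
have [->|[i iS0]] := set_0Vmem S0.
  rewrite cards0 mul0n leqn0 cards_eq0; apply/eqP/setP => p.
  by rewrite !inE mix_set0 eqxx andbF.
move: ltSn; rewrite -(finset.setD1K iS0); move: (S0 :\ i)%SET (finset.setD11 i S0).
move=> S /negbT iS; rewrite finset.cardsU1 iS ltnS => /IHn IH {S0 iS0}.
set B := [set v in W | (v \in E) != m i v].
have BW : B \subset W by apply/fintype.subsetP => v; rewrite inE => /andP[].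
have BN S' : (#|[set p in finset.setX W W | mix S' p.1 p.2 \in B]| <= N * #|W|)%N.
  by apply: leq_trans (card_mix S' BW) _; rewrite leq_mul2r cardN orbT.
rewrite mulnDl mul1n mul2n -addnn.
pose P1 := [set p in finset.setX W W | mix S p.1 p.2 \in B].
pose P2 := [set p in finset.setX W W | mix (i |: S) p.1 p.2 \in B].
pose P3 := [set p in finset.setX W W | (p.1 \in E) != (mix S p.1 p.2 \in E)].
have sub : [set p in finset.setX W W | (p.1 \in E) != (mix (i |: S) p.1 p.2 \in E)]
   \subset (P1 :|: P2 :|: P3)%SET.
  apply/fintype.subsetP => -[x y]; rewrite inE finset.in_setX => /andP[/andP[Wx Wy]].
  have inW (P : pred (V * V)) : ((x, y) \in [set p in finset.setX W W | P p]) = P (x, y).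
    by rewrite inE finset.in_setX Wx Wy.
  rewrite !finset.in_setU !inW /= ![_ \in B]inE !mix_setXn //=.
  have -> : m i (mix S x y) = m i (mix (i |: S) x y).
    by apply: mE => j ji; rewrite !ffunE !inE (negPf ji).
  by case: (x \in E); case: (mix S x y \in E);
    case: (mix (i |: S) x y \in E); case: (m i _).
apply: leq_trans (subset_leq_card sub) _.
apply: leq_trans (leq_card_setU _ _) _; apply: leq_add; last first.
  by move: IH; rewrite mul2n -addnn.
apply: leq_trans (leq_card_setU _ _) _; apply: leq_add; exact: BN.
Qed.

(* Changing the coordinates of a point of the box one at a time leads from it *)
(* to an independent one, and each step rarely changes membership in E.       *)
Lemma box_homogeneous :
  (#|E :&: W| * #|W :\: E| <= #|I| * (2 * (N * #|W|)))%N.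
Proof.
rewrite -cardsX -cardsT; apply: leq_trans (card_mix_neq [set: I]%SET).
apply/subset_leq_card/fintype.subsetP => -[x y].
rewrite finset.in_setX finset.in_setI finset.in_setD.
move=> /andP[/andP[Ex Wx] /andP[/negPf Ey Wy]].
by rewrite inE finset.in_setX mix_setT /= Ex Wx Ey Wy.
Qed.

End Mix.

(** * Random samples and the sets they define *)

Section Sampling.
Variable R : realFieldType.

Lemma bernoulli_ge (q : R) M : 0 <= q <= 1 -> 1 - (1 - q) ^+ M <= M%:R * q.
Proof.
move=> /andP[q0 q1]; elim: M => [|M IH]; first by rewrite expr0 subrr mul0r.
have h0 : 0 <= (1 - q) ^+ M by rewrite exprn_ge0 ?subr_ge0.
have h1 : (1 - q) ^+ M <= 1 by rewrite exprn_ile1 ?subr_ge0 // lerBlDr lerDl.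
have := mulr_ge0 q0 h0; have : q * (1 - q) ^+ M <= q by rewrite ler_piMr.
by rewrite exprS mulrBl mul1r -natr1 mulrDl mul1r; lra.
Qed.

(** The telescoping sum of q (1 - q)^l over l <= M equals 1 - (1 - q)^(M+1), which is at most 1, and
    its last term is the least of its M+1 terms. *)
Lemma mulr_exp_onem_le (q : R) M : 0 <= q <= 1 -> q * (1 - q) ^+ M <= M.+1%:R^-1.
Proof.
move=> /andP[q0 q1].
have r1 : 0 <= 1 - q by rewrite subr_ge0.
have h0 n : 0 <= (1 - q) ^+ n by rewrite exprn_ge0.
rewrite -[leRHS]mul1r ler_pdivlMr ?ltr0n //.
suff : (q * (1 - q) ^+ M) * M.+1%:R <= 1 - (1 - q) ^+ M.+1.
  by move/le_trans; apply; rewrite lerBlDr lerDl.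
elim: M => [|M IH]; first by rewrite expr0 expr1; lra.
rewrite -natr1 mulrDr mulr1.
have : q * (1 - q) ^+ M.+1 * M.+1%:R <= q * (1 - q) ^+ M * M.+1%:R.
  rewrite ler_pM2r ?ltr0n // ler_wpM2l // exprS ler_piMl //.
  by rewrite lerBlDr lerDl.
by rewrite (exprS _ M.+1) mulrBl mul1r; lra.
Qed.

Variables (X Y : finType) (E : X -> Y -> bool).

Definition predicted M (m : pred Y) (s : {ffun 'I_M -> Y}) : {set X} :=
  [set x | [forall l, E x (s l) == m (s l)]].

Definition disagreement (B : {set X}) (m : pred Y) : nat :=
  #|[set p : X * Y | (p.1 \in B) && (E p.1 p.2 != m p.2)]|.

Lemma disagreementE (B : {set X}) (m : pred Y) :
  disagreement B m = (\sum_(x in B) #|[set y | E x y != m y]|)%N.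
Proof.
rewrite /disagreement -sum1_card.
under eq_bigl do rewrite inE.
rewrite -(pair_big_dep (mem B) (fun x y => E x y != m y) (fun _ _ => 1%N)) /=.
by apply: eq_bigr => x _; rewrite -sum1_card; apply: eq_bigl => y; rewrite inE.
Qed.

Hypothesis Y0 : (0 < #|Y|)%N.

(** The entries of a sample are independent, and [x] survives each of them with probability 1 -
    q. *)
Lemma card_predicted M (m : pred Y) x (q := #|[set y | E x y != m y]|%:R / #|Y|%:R) :
  0 <= q <= 1 /\
  #|[set s : {ffun 'I_M -> Y} | x \in predicted m s]|%:R
     = (1 - q) ^+ M * #|Y|%:R ^+ M :> R.
Proof.
have Y0' : 0 < #|Y|%:R :> R by rewrite ltr0n.
have -> : #|[set s : {ffun 'I_M -> Y} | x \in predicted m s]| =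
          (#|[pred y | E x y == m y]| ^ M)%N.
  rewrite -[M in RHS]card_ord -card_ffun_on; apply: eq_card => s.
  rewrite !inE; apply/forallP/ffun_onP => h l; have := h l; by rewrite ?inE.
split.
  rewrite divr_ge0 ?ler0n //= ler_pdivrMr // mul1r ler_nat; exact: max_card.
rewrite natrX -exprMn; congr (_ ^+ _).
rewrite /q mulrBl mul1r divfK ?gt_eqF //; apply/eqP; rewrite eq_sym subr_eq; apply/eqP.
rewrite -natrD; congr _%:R; rewrite -(cardC [pred y | E x y == m y]); congr addn.
by rewrite cardsE; apply: eq_card => y; rewrite !inE.
Qed.

Variables (n : nat) (B : 'I_n -> {set X}) (m : 'I_n -> pred Y) (eta : R) (M : nat).
Hypothesis Bm : forall j, (disagreement (B j) (m j))%:R <= eta * (#|X|%:R * #|Y|%:R).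

(* The expectation over the samples of a point x whose prediction has error q *)
(* is at most M q + 1/(M+1) times #|Y|, as q (1 - q)^M <= 1/(M+1).            *)
Lemma sampling (tau := n%:R * (M%:R * eta + M.+1%:R^-1)) :
  exists s : {ffun 'I_M -> Y}, forall j,
    #|B j :\: predicted (m j) s|%:R <= tau * #|X|%:R /\
    (disagreement (predicted (m j) s) (m j))%:R <= tau * (#|X|%:R * #|Y|%:R).
Proof.
have Y0' : 0 < #|Y|%:R :> R by rewrite ltr0n.
(* The loss of a sample. The factor [#|Y|] puts both terms on the scale [#|X| * #|Y|], so that one
   bound on their sum over [j] yields both conclusions for every [j]. *)
pose S (s : {ffun 'I_M -> Y}) j : R := #|B j :\: predicted (m j) s|%:R * #|Y|%:R +
   (disagreement (predicted (m j) s) (m j))%:R.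
have S0 s j : 0 <= S s j by rewrite addr_ge0 ?mulr_ge0 ?ler0n.
suff [s Ss] : exists s, \sum_j S s j <= tau * (#|X|%:R * #|Y|%:R).
  exists s => j; have Sj : S s j <= tau * (#|X|%:R * #|Y|%:R).
    apply: le_trans Ss; rewrite (bigD1 j) //= lerDl sumr_ge0 // => i _.
  split.
    rewrite -(ler_pM2r Y0') -mulrA; apply: le_trans Sj.
    by rewrite lerDl ler0n.
  by apply: le_trans Sj; rewrite lerDr mulr_ge0 ?ler0n.
(* Averaging: if every sample had too large a loss, the sum over all [A] samples would exceed the
   bound computed in [high]. *)
apply: contrapT => /forallNP noS.
pose A : R := #|Y|%:R ^+ M.
have A0 : 0 < A by rewrite exprn_gt0.
have cardA : \sum_(s : {ffun 'I_M -> Y}) (1 : R) = A.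
  by rewrite sumr_const card_ffun card_ord natrX.
have low : tau * (#|X|%:R * #|Y|%:R) * A < \sum_s \sum_j S s j.
  have [s0 _] : exists s : {ffun 'I_M -> Y}, true.
    by case/card_gt0P: Y0 => y _; exists [ffun=> y].
  rewrite -cardA mulr_sumr; apply: ltr_sum => [|s _].
    by apply/hasP; exists s0 => //; rewrite mem_index_enum.
  rewrite mulr1 ltNge; exact/negP/noS.
have high j : \sum_s S s j <= (M%:R * eta + M.+1%:R^-1) * (#|X|%:R * #|Y|%:R) * A.
  pose q x : R := #|[set y | E x y != m j y]|%:R / #|Y|%:R.
  have qp x : 0 <= q x <= 1 by have [] := card_predicted M (m j) x.
  pose ins (s : {ffun 'I_M -> Y}) x : R := (x \in predicted (m j) s)%:R.
  have insE x : \sum_(s : {ffun 'I_M -> Y}) ins s x = (1 - q x) ^+ M * A.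
    have [_ <-] := card_predicted M (m j) x.
    rewrite -sum1_card natr_sum [RHS]big_mkcond /=.
    by apply: eq_bigr => s _; rewrite inE /ins; case: (_ \in _).
  have SE s : S s j = \sum_(x in B j) (1 - ins s x) * #|Y|%:R
                    + \sum_x q x * #|Y|%:R * ins s x.
    rewrite /S; congr (_ + _).
      rewrite -mulr_suml; congr (_ * _).
      rewrite -sum1_card natr_sum [LHS]big_mkcond [RHS]big_mkcond /=.
      apply: eq_bigr => x _; rewrite finset.in_setD /ins.
      by case: (x \in predicted _ _); case: (x \in B j); rewrite /= ?subrr ?subr0.
    rewrite disagreementE natr_sum [LHS]big_mkcond /=; apply: eq_bigr => x _.
    rewrite /ins /q divfK ?gt_eqF //.
    by case: (x \in _); rewrite ?mulr1 ?mulr0.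
  under eq_bigr do rewrite SE.
  rewrite big_split /= exchange_big /= [X in _ + X]exchange_big /=.
  (* Points lost from [B j] are controlled by Bernoulli's inequality and [Bm]. Errors on the
     surviving points are controlled pointwise by [mulr_exp_onem_le], over all of [X]. *)
  rewrite mulrDl mulrDl; apply: lerD.
    apply: (@le_trans _ _ (\sum_(x in B j) (M%:R * q x) * (#|Y|%:R * A))).
      apply: ler_sum => x _.
      rewrite -mulr_suml sumrB insE cardA.
      have -> : (A - (1 - q x) ^+ M * A) * #|Y|%:R =
        (1 - (1 - q x) ^+ M) * (#|Y|%:R * A) by ring.
      rewrite ler_pM2r ?mulr_gt0 //; exact: bernoulli_ge.
    rewrite -mulr_suml -mulr_sumr !mulrA ler_pM2r // -!mulrA ler_wpM2l ?ler0n //.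
    apply: le_trans _ (Bm j); rewrite disagreementE natr_sum mulr_suml.
    by apply: ler_sum => x _; rewrite /q divfK ?gt_eqF.
  apply: (@le_trans _ _ (\sum_(x : X) M.+1%:R^-1 * (#|Y|%:R * A))).
    apply: ler_sum => x _; rewrite -mulr_sumr insE.
    have -> : q x * #|Y|%:R * ((1 - q x) ^+ M * A) =
      q x * (1 - q x) ^+ M * (#|Y|%:R * A) by ring.
    by rewrite ler_pM2r ?mulr_gt0 //; exact: mulr_exp_onem_le.
  rewrite sumr_const -[_ *+ _]mulr_natl cardT -cardE.
  by rewrite le_eqVlt; apply/orP; left; apply/eqP; ring.
move: low; rewrite exchange_big /= ltNge => /negP; apply.
apply: (le_trans (ler_sum _ (fun j _ => high j))).
by rewrite sumr_const card_ord -[_ *+ n]mulr_natl /tau !mulrA.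
Qed.

End Sampling.

(** * Internal sets *)

Local Open Scope classical_set_scope.
Local Open Scope ring_scope.
Local Open Scope quotient_scope.

Lemma near_ultraC (U : set_system nat) (UU : UltraFilter U) (P : nat -> Prop) :
  ~ (\forall n \near U, P n) -> \forall n \near U, ~ P n.
Proof. by move=> nP; have [/nP|] := in_ultra_setVsetC P UU. Qed.

Section Internal.
Variables (U : set_system nat) (UU : UltraFilter U) (T : nat -> neFinType).
Implicit Types (A B : forall n, {set T n}) (x : forall n, T n).

Lemma ultra_reprK x : \forall n \near U, ultra_repr (ultra_class UU x) n = x n.
Proof.
have : ultra_eq U (ultra_repr (ultra_class UU x)) x.
  have := reprK (ultra_class UU x : {eq_quot ultra_equiv UU T}).
  by move/eqmodP.
by move/asboolP.
Qed.

Lemma ultra_class_eq x y : (\forall n \near U, x n = y n) ->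
  ultra_class UU x = ultra_class UU y.
Proof. by move=> xy; apply/eqmodP; apply/asboolP. Qed.

Lemma ultra_classK (z : ultraproduct UU T) : ultra_class UU (ultra_repr z) = z.
Proof. exact: (@reprK _ ({eq_quot ultra_equiv UU T})). Qed.

Lemma internal_class A x :
  internal_set A (ultra_class UU x) <-> \forall n \near U, x n \in A n.
Proof.
have xK := ultra_reprK x.
by split; rewrite /internal_set /=; apply: filterS2 xK => n ->.
Qed.

Lemma internal_setC A : ~` @internal_set U UU T A = internal_set (fun n => ~: A n)%SET.
Proof.
apply/seteqP; split => z; rewrite /internal_set /setC /=.
  by move=> /(near_ultraC UU); apply: filterS => n /negP; rewrite finset.in_setC.
move=> zA zA'; apply: (@filter_not_empty _ U).
by apply: filterS2 zA zA' => n; rewrite finset.in_setC => /negP.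
Qed.

Lemma internal_setI A B : @internal_set U UU T A `&` internal_set B =
  internal_set (fun n => A n :&: B n)%SET.
Proof.
apply/seteqP; split => z; rewrite /internal_set /setI /=.
  by move=> [zA zB]; apply: filterS2 zA zB => n; rewrite finset.in_setI => -> ->.
by move=> zAB; split; apply: filterS zAB => n; rewrite finset.in_setI => /andP[].
Qed.

Lemma internal_setD A B : @internal_set U UU T A `\` internal_set B =
  internal_set (fun n => A n :\: B n)%SET.
Proof.
rewrite setDE internal_setC internal_setI; congr internal_set.
by apply: functional_extensionality_dep => n; rewrite finset.setDE.
Qed.

Lemma internal_setU A B : @internal_set U UU T A `|` internal_set B =
  internal_set (fun n => A n :|: B n)%SET.
Proof.
apply: setC_inj; rewrite setCU !internal_setC internal_setI; congr internal_set.
by apply: functional_extensionality_dep => n; rewrite finset.setCU.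
Qed.

Lemma internal_set0 : @internal_set U UU T (fun=> finset.set0) = set0.
Proof.
apply/seteqP; split => z //; rewrite /internal_set /= => z0.
by apply: (@filter_not_empty _ U); apply: filterS z0 => n; rewrite inE.
Qed.

Lemma internal_setT : @internal_set U UU T (fun=> finset.setT) = setT.
Proof.
rewrite -setC0 -internal_set0 internal_setC; congr internal_set.
by apply: functional_extensionality_dep => n; rewrite finset.setC0.
Qed.

Lemma internal_set_eq0 A : @internal_set U UU T A = set0 ->
  \forall n \near U, A n = finset.set0.
Proof.
move=> A0; apply: contrapT => /(near_ultraC UU) An0.
(* A point of [A n] wherever there is one; the default is used only on a set of indices outside
   [U]. *)
pose x n := odflt (neFin_point (T n)) [pick y in A n].
suff : internal_set A (ultra_class UU x) by rewrite A0.
apply/internal_class; apply: filterS An0 => n /eqP/finset.set0Pn[y yA].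
by rewrite /x; case: pickP => // /(_ y); rewrite yA.
Qed.

Lemma internal_set_inj A B : @internal_set U UU T A = internal_set B ->
  \forall n \near U, A n = B n.
Proof.
move=> AB.
have /internal_set_eq0 D1 : @internal_set U UU T (fun n => A n :\: B n)%SET = set0.
  by rewrite -internal_setD AB setDv.
have /internal_set_eq0 D2 : @internal_set U UU T (fun n => B n :\: A n)%SET = set0.
  by rewrite -internal_setD AB setDv.
apply: filterS2 D1 D2 => n /eqP + /eqP; rewrite !finset.setD_eq0 => h1 h2.
by apply/eqP; rewrite finset.eqEsubset h1.
Qed.

(** Diagonal choice: at index [n], take a point lying in as many initial sets [A 0 n], [A 1 n], ...
    as possible, but in at most [n] of them so that a maximum exists. For fixed [i], almost all [n]
    exceed [i] and allow the first [i.+1] sets, so the chosen point lies in [A i n]. *)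
Lemma saturation (F : nat -> set (ultraproduct UU T)) : \oo `<=` U ->
  (forall i, internal_sets (F i)) -> (forall n, \bigcap_(i < n) F i !=set0) ->
  \bigcap_i F i !=set0.
Proof.
move=> Uoo Fint Fn0.
pose A i : forall n, {set T n} := projT1 (cid2 (Fint i)).
have AE i : internal_set (A i) = F i by rewrite /A; case: cid2.
pose good n k := [pick y : T n | [forall i : 'I_k, y \in A i n]].
pose x n := odflt (neFin_point (T n)) (good n (\max_(k < n.+1 | good n k) k)%N).
exists (ultra_class UU x) => i _; rewrite -AE; apply/internal_class.
have [z zF] := Fn0 i.+1.
have : \forall n \near U, forall j : 'I_i.+1, ultra_repr z n \in A j n.
  apply: filter_forall => j; have := zF j (ltn_ord j); by rewrite -AE.
have : \forall n \near U, (i < n)%N by apply: Uoo; exists i.+1.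
apply: filterS2 => n lt_in zA.
have : good n i.+1.
  by rewrite /good; case: pickP => // /(_ (ultra_repr z n))/forallP/(_ zA).
move=> gi; have lti : (i.+1 < n.+1)%N by [].
have [/= k gk km] := @eq_bigmax_cond _ (fun k : 'I_n.+1 => good n k) (fun k => k : nat)
  (ltac:(apply/card_gt0P; exists (Ordinal lti); exact: gi)).
have ik : (i < k)%N.
  by rewrite -km; exact: (@leq_bigmax_cond _ (fun k : 'I_n.+1 => good n k)
    (fun k => k : nat) (Ordinal lti) gi).
rewrite /x km; move: (gk : good n k); rewrite /good; case: pickP => //= y /forallP yA _.
exact: (yA (Ordinal ik)).
Qed.
End Internal.

(** * The Loeb measure *)

Lemma ultra_bounded_cvg (R : realType) (U : set_system nat) (UU : UltraFilter U)
    (u : nat -> R) (a b : R) : (forall n, u n \in `[a, b]) -> exists l : R, u @ U --> l.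
Proof.
move=> uab.
have [l [_ lu]] : `[a, b]%classic `&` cluster (u @ U) !=set0.
  apply: segment_compact; exact: (@filterE nat U _ _ uab).
exists l => V Vl; apply: contrapT => /(near_ultraC UU) nV.
by have [r [/= ]] := lu (~` V) V nV Vl.
Qed.

Section LoebMeasure.
Variables (R : realType) (U : set_system nat) (UU : UltraFilter U).
Variable T : nat -> neFinType.
Implicit Types (A B : forall n, {set T n}).

Definition freq A n : R := #|A n|%:R / #|{: T n}|%:R.

Lemma freq_itv A n : freq A n \in `[0, 1].
Proof.
rewrite in_itv /= divr_ge0 ?ler0n //= ler_pdivrMr ?ltr0n ?neFin_gt0 // mul1r ler_nat.
exact: max_card.
Qed.

Definition ulim A : R := xget 0 [set l | freq A @ U --> l].

Lemma freq_cvg A : freq A @ U --> ulim A.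
Proof.
exact: (@xgetPex _ 0 [set l | freq A @ U --> l] (ultra_bounded_cvg UU (freq_itv A))).
Qed.

Lemma ulimP A (l : R) : freq A @ U --> l -> ulim A = l.
Proof. by move=> Al; apply: cvg_unique (@freq_cvg A) Al; exact: Rhausdorff. Qed.

Lemma ulim_ge0 A : 0 <= ulim A.
Proof.
apply: (cvgr_to_ge (@freq_cvg A)).
by apply: nearW => n; have /andP[] := freq_itv A n.
Qed.

Lemma ulim_internal A B : @internal_set U UU T A = internal_set B -> ulim A = ulim B.
Proof.
move=> /internal_set_inj AB; apply: ulimP; apply: cvg_trans (@freq_cvg B).
by apply: near_eq_cvg; apply: filterS AB => n; rewrite /freq => ->.
Qed.

(* A copy of the ultraproduct on which only the internal sets are measurable. *)
Definition internalType : Type := ultraproduct UU T.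
HB.instance Definition _ := Pointed.on internalType.

Fact internal_display : measure_display. Proof. by []. Qed.

Let int0 : @internal_sets U UU T set0.
Proof. by exists (fun=> finset.set0) => //; rewrite internal_set0. Qed.

Let intU : setU_closed (@internal_sets U UU T).
Proof. by move=> _ _ [A _ <-] [B _ <-]; rewrite internal_setU; eexists. Qed.

Let intC : setC_closed (@internal_sets U UU T).
Proof. by move=> _ [A _ <-]; rewrite internal_setC; eexists. Qed.

HB.instance Definition _ := @isAlgebraOfSets.Build internal_display internalType
  (@internal_sets U UU T) int0 intU intC.

(** An internal set determines its sequence only up to [U]-almost equality; [ulim_internal] makes
    the choice of representative immaterial. *)
Definition premeasure (X : set internalType) : \bar R :=
  (ulim (xget (fun=> finset.set0) [set A | internal_set A = X]))%:E.

Lemma premeasureE A : premeasure (internal_set A) = (ulim A)%:E.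
Proof.
congr (_%:E); apply: ulim_internal.
exact: (@xgetPex _ _ [set B | internal_set B = internal_set A] (ex_intro _ A erefl)).
Qed.

Lemma premeasure0 : premeasure set0 = 0%E.
Proof.
rewrite -(@internal_set0 _ UU) premeasureE; congr (_%:E); apply: ulimP.
by apply: cvg_near_cst; apply: nearW => n; rewrite /freq cards0 mul0r.
Qed.

Lemma premeasureU (X Y : set internalType) : measurable X -> measurable Y ->
  X `&` Y = set0 -> premeasure (X `|` Y) = (premeasure X + premeasure Y)%E.
Proof.
move=> [A _ <-] [B _ <-].
rewrite internal_setI internal_setU !premeasureE => /internal_set_eq0 AB0.
rewrite -EFinD; congr (_%:E); apply: ulimP.
apply: cvg_trans; last exact: cvgD (@freq_cvg A) (@freq_cvg B).
apply: near_eq_cvg; apply: filterS AB0 => n AB0.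
by rewrite /freq cardsU AB0 cards0 subn0 natrD mulrDl.
Qed.

Let premeasure_ge0 X : (0 <= premeasure X)%E.
Proof. by rewrite lee_fin ulim_ge0. Qed.

Let premeasure_semi_additive : measure_function.semi_additive premeasure.
Proof.
move=> F n mF tF _; elim: n => [|n IH]; first by rewrite !big_ord0 premeasure0.
rewrite !big_ord_recr /= premeasureU ?IH //.
  exact: bigsetU_measurable.
rewrite -bigcup_mkord; apply/seteqP; split => // z [[i /= lt_in zi] zn].
by have := tF i n I I (ex_intro _ z (conj zi zn)) => ei; move: lt_in; rewrite ei ltnn.
Qed.

HB.instance Definition _ := isContent.Build internal_display internalType R premeasure
  premeasure_ge0 premeasure_semi_additive.

Hypothesis Uoo : \oo `<=` U.

(* By saturation, an internal set that is a countable disjoint union of       *)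
(* internal sets is the union of finitely many of them.                       *)
Lemma premeasure_semi_sigma_additive : semi_sigma_additive premeasure.
Proof.
move=> F mF tF mUF.
(* If infinitely many [F i] were nonempty, disjointness would give the sets [\bigcup_n F n] minus
   [F i] the finite intersection property. By saturation some point of the union would then avoid
   every [F i]. *)
have [N FN] : exists N, forall n, (N <= n)%N -> F n = set0.
  apply: contrapT => /forallNP noN.
  have [z zG] : \bigcap_i (\bigcup_n F n `\` F i) !=set0.
    apply: (saturation Uoo) => [i|n]; first exact: (@measurableD _ internalType).
    have /existsNP[i /not_implyP[ni /eqP/set0P[z zi]]] := noN n.
    exists z => j /= ltjn; split; first by exists i.
    move=> zj; have ij := tF i j I I (ex_intro _ z (conj zi zj)).
    by move: ni; rewrite ij leqNgt ltjn.
  have [[i _ zi] _] := zG 0%N I; have [_ nzi] := zG i I; exact: nzi.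
apply: cvg_near_cst; exists N => // n /= leNn.
rewrite big_mkord -measure_semi_additive //; last exact: bigsetU_measurable.
congr premeasure; rewrite -bigcup_mkord; apply/seteqP; split => z [i _ zi]; exists i => //=.
by rewrite ltnNge; apply/negP => ni; move: zi; rewrite FN // (leq_trans leNn).
Qed.

(** Caratheodory extension of [premeasure] from the algebra of internal sets to the generated
    sigma-algebra. *)
Lemma loeb_measure_exists : exists mu : probability (loebType UU T) R, is_loeb_measure mu.
Proof.
pose c := Content_isMeasure.Build _ _ _ premeasure premeasure_semi_sigma_additive.
pose m : {measure set internalType -> \bar R} := HB.pack premeasure c.
pose me := @measure_extension internal_display internalType R m.
have meE A : me (internal_set A) = (ulim A)%:E.
  rewrite -premeasureE /me /measure_extension (@measurable_mu_extE _ _ _ m) //.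
  by exists A.
have me1 : me setT = 1%E.
  rewrite -(@internal_setT _ UU) meE; congr (_%:E); apply: ulimP.
  apply: cvg_near_cst; apply: nearW => n.
  by rewrite /freq cardsT divff // pnatr_eq0 -lt0n neFin_gt0.
pose p := Measure_isProbability.Build _ _ _ me me1.
pose mu : probability (loebType UU T) R := HB.pack me p.
exists mu => A; rewrite /= meE; exact: cvg_comp (@freq_cvg A) _.
Qed.

End LoebMeasure.

(** * Approximation of measurable sets by internal sets *)

Section Approximation.
Variables (R : realType) (U : set_system nat) (UU : UltraFilter U).
Variable T : nat -> neFinType.
Implicit Types (A B : forall n, {set T n}).
Variable mu : probability (loebType UU T) R.

Lemma measurable_internal A : measurable (internal_set A : set (loebType UU T)).
Proof. by apply: sub_sigma_algebra; exists A. Qed.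

Definition approximable (X : set (loebType UU T)) := measurable X /\
  forall e : R, 0 < e -> exists A, (mu (X `\` internal_set A) <= e%:E)%E /\
    (mu (internal_set A `\` X) <= e%:E)%E.

Lemma le_measureU2 X Y Z : measurable X -> measurable Y -> measurable Z ->
  Z `<=` X `|` Y -> (mu Z <= mu X + mu Y)%E.
Proof.
move=> mX mY mZ ZXY; apply: (@le_trans _ _ (mu (X `|` Y))); last exact: measureU2.
by apply: le_measure; rewrite ?inE //; exact: measurableU.
Qed.

Lemma approximable_internal A : approximable (internal_set A).
Proof.
split; first exact: measurable_internal.
by move=> e e0; exists A; rewrite setDv measure0 lee_fin ltW.
Qed.

Lemma approximableU X Y : approximable X -> approximable Y -> approximable (X `|` Y).
Proof.
move=> [mX aX] [mY aY]; split=> [|e e0]; first exact: measurableU.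
have e20 : 0 < e / 2 by rewrite divr_gt0.
have [A [A1 A2]] := aX _ e20; have [B [B1 B2]] := aY _ e20.
exists (fun n => A n :|: B n)%SET; rewrite -internal_setU.
have mA := measurable_internal A; have mB := measurable_internal B.
rewrite (splitr e) EFinD; split.
- apply: (le_trans _ (leeD A1 B1)); apply: le_measureU2; try exact: measurableD.
    by apply: measurableD; exact: measurableU.
  by move=> z [[zX|zY] /not_orP[nA nB]]; [left|right].
- apply: (le_trans _ (leeD A2 B2)); apply: le_measureU2; try exact: measurableD.
    by apply: measurableD; exact: measurableU.
  by move=> z [[zX|zY] /not_orP[nA nB]]; [left|right].
Qed.

Lemma approximable_bigcup (F : nat -> set (loebType UU T)) :
  (forall i, approximable (F i)) -> approximable (\bigcup_i F i).
Proof.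
move=> aF; have mF i : measurable (F i) by have [] := aF i.
have mUF : measurable (\bigcup_i F i) by exact: bigcupT_measurable.
split=> // e e0; have e20 : 0 < e / 2 by rewrite divr_gt0.
pose G n := \big[setU/set0]_(i < n) F i.
have aG n : approximable (G n).
  rewrite /G; elim: n => [|n IH].
    rewrite big_ord0 -(@internal_set0 _ UU T); exact: approximable_internal.
  by rewrite big_ord_recr; exact: approximableU.
have mG n : measurable (G n) by have [] := aG n.
have GF n : G n `<=` \bigcup_i F i by rewrite /G -bigcup_mkord => z [i _ zi]; exists i.
(* The remainders decrease to the empty set, so by continuity from above a finite union already
   carries all but [e / 2] of the measure. *)
have [n Gn] : exists n, (mu (\bigcup_i F i `\` G n) <= (e / 2)%:E)%E.
  have : mu \o (fun n => \bigcup_i F i `\` G n) @ \oo --> mu (\bigcap_n (\bigcup_i F i `\` G n)).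
    apply: nonincreasing_cvg_mu => [|n||].
    - by apply: (@le_lt_trans _ _ 1%E); [apply: probability_le1; exact: measurableD|exact: ltry].
    - exact: measurableD.
    - by apply: bigcapT_measurable => n; exact: measurableD.
    - move=> p q pq; apply/subsetPset => z [zF nz]; split => // zp; apply: nz.
      move: zp; rewrite /G -!bigcup_mkord => -[i /= ip zi].
      by exists i => //=; exact: leq_trans ip pq.
  rewrite (_ : \bigcap_n _ = set0); last first.
    apply/seteqP; split => // z zG; have [[i _ zi] _] := zG 0%N I.
    have [_] := zG i.+1 I; apply; rewrite /G big_ord_recr; by right.
  rewrite measure0 => /fine_cvgP[_ /cvgr_lt /(_ _ e20)] [N _ /(_ N (leqnn _)) /=] h.
  exists N; rewrite -[leLHS]fineK ?lee_fin 1?ltW //.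
  by apply: fin_num_measure; exact: measurableD.
have [A [A1 A2]] := (aG n).2 _ e20; exists A.
have mA := measurable_internal A.
split.
- rewrite (splitr e) EFinD; apply: (le_trans _ (leeD Gn A1)).
  apply: le_measureU2; try exact: measurableD.
  by move=> z [zF nA]; have [zG|nG] := pselect (G n z); [right|left].
- apply: (@le_trans _ _ (e / 2)%:E); last by rewrite lee_fin; lra.
  apply: le_trans A2; apply: le_measure; rewrite ?inE; try exact: measurableD.
  by move=> z [zA nF]; split => // /GF.
Qed.

Lemma approximableC X : approximable X -> approximable (~` X).
Proof.
move=> [mX aX]; split=> [|e /aX[A [A1 A2]]]; first exact: measurableC.
exists (fun n => ~: A n)%SET; rewrite -internal_setC !setDE !setCK.
by rewrite setIC -setDE A2 setIC -setDE.
Qed.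

(** The approximable sets form a sigma-algebra containing the internal sets. *)
Lemma measurable_approximable X : measurable X -> approximable X.
Proof.
move: X; apply: smallest_sub; last by move=> _ [A _ <-]; exact: approximable_internal.
split.
- rewrite -(@internal_set0 _ UU T); exact: approximable_internal.
- by move=> X aX; rewrite setTD; exact: approximableC.
- exact: approximable_bigcup.
Qed.

Hypothesis mu_loeb : is_loeb_measure mu.

Lemma loeb_freq A : freq R A @ U --> fine (mu (internal_set A)).
Proof.
have := @mu_loeb A; rewrite -[X in _ --> X]fineK; last first.
  by apply: fin_num_measure; exact: measurable_internal.
by move/fine_cvg.
Qed.

Lemma loeb_freq_lt A (r : R) : (mu (internal_set A) < r%:E)%E ->
  \forall n \near U, #|A n|%:R < r * #|{: T n}|%:R.
Proof.
move=> Ar; have : fine (mu (internal_set A)) < r.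
  rewrite -lte_fin fineK //; apply: fin_num_measure; exact: measurable_internal.
have FU : Filter U by exact: _.
move=> fr; have frn := @cvgr_lt R nat U FU _ _ (@loeb_freq A) _ fr.
apply: filterS frn => n.
by rewrite /freq ltr_pdivrMr ?ltr0n ?neFin_gt0.
Qed.

Lemma loeb_freq_gt A (r : R) : (r%:E < mu (internal_set A))%E ->
  \forall n \near U, r * #|{: T n}|%:R < #|A n|%:R.
Proof.
move=> Ar; have : r < fine (mu (internal_set A)).
  rewrite -lte_fin fineK //; apply: fin_num_measure; exact: measurable_internal.
have FU : Filter U by exact: _.
move=> fr; have frn := @cvgr_gt R nat U FU _ _ (@loeb_freq A) _ fr.
apply: filterS frn => n.
by rewrite /freq ltr_pdivlMr ?ltr0n ?neFin_gt0.
Qed.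

End Approximation.

(** * From perfect sets to finite hypergraphs *)

(** Predict membership exactly when few points of [B] lie outside the fiber. Over a [y] that does
    not split [B] into two large pieces this errs on at most [s * #|X|] points. Over each of the few
    remaining [y] it errs on at most [#|X|]. *)
Lemma majority_disagreement (R : realFieldType) (X Y : finType) (E : X -> Y -> bool)
    (B : {set X}) (s r : R) : 0 <= s ->
  #|[set y | (s * #|X|%:R < #|[set x in B | E x y]%SET|%:R) &&
             (s * #|X|%:R < #|[set x in B | ~~ E x y]%SET|%:R)]%SET|%:R <= r * #|Y|%:R ->
  exists m : pred Y, (disagreement E B m)%:R <= (s + r) * (#|X|%:R * #|Y|%:R).
Proof.
move=> s0; set Bad := (X in #|X|%:R <= _) => Badr.
pose m y := #|[set x in B | ~~ E x y]%SET|%:R <= s * #|X|%:R.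
exists m.
have -> : disagreement E B m = (\sum_y #|[set x in B | E x y != m y]%SET|)%N.
  rewrite disagreementE; under eq_bigr do rewrite -sum1_card big_mkcond.
  rewrite exchange_big /=; apply: eq_bigr => y _.
  rewrite -sum1_card big_mkcond [RHS]big_mkcond /=; apply: eq_bigr => x _.
  by rewrite !inE; case: (x \in B); case: (_ != _).
rewrite natr_sum.
apply: (@le_trans _ _ (\sum_y (s * #|X|%:R + (y \in Bad)%:R * #|X|%:R))).
  apply: ler_sum => y _; have [yB|] := boolP (y \in Bad).
    rewrite mul1r; apply: (@le_trans _ _ #|X|%:R); first by rewrite ler_nat max_card.
    by rewrite lerDr mulr_ge0.
  rewrite mul0r addr0 inE negb_and -!leNgt; case: (boolP (m y)) => my.
    move=> _; apply: le_trans my; rewrite ler_nat; apply: subset_leq_card.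
    by apply/fintype.subsetP => x; rewrite !inE; case: (E x y).
  move: my; rewrite {1}/m => /negbTE ->; rewrite orbF => h; apply: le_trans h.
  rewrite ler_nat; apply: subset_leq_card.
  by apply/fintype.subsetP => x; rewrite !inE; case: (E x y).
rewrite big_split /= sumr_const -mulr_suml mulrDl; apply: lerD.
  by rewrite cardT -cardE -[_ *+ _]mulr_natr mulrA.
rewrite mulrCA mulrC ler_wpM2l ?ler0n //; apply: le_trans Badr.
by rewrite -natr_sum ler_nat -sum1_card [leqRHS]big_mkcond.
Qed.

Definition in_fiber k (G : hypergraph k) t (x : part G t) (y : coprod G t) :=
  x \in fiber y.

Section Fibers.
Variables (R : realType) (U : set_system nat) (UU : UltraFilter U).
Variables (k : nat) (G : nat -> hypergraph k) (t : 'I_k).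
Notation X n := (part (G n) t).
Notation Y n := (coprod (G n) t).

(** The theorem of Los for the formula defining a fiber: witnessing edges at the indices [n]
    assemble into an edge of the ultraproduct. Fibers are therefore internal, hence measurable, with
    measures that are limits of finite frequencies. *)
Lemma ufiberE (b : ucoprod UU G t) :
  ufiber b = internal_set (fun n => fiber (ultra_repr b n)).
Proof.
apply/seteqP; split => [_ [e [eE eb] <-]|x]; rewrite /internal_set /=.
  have := ultra_reprK UU (fun n => vproj t (ultra_repr e n)).
  have := ultra_reprK UU (fun n => vrestr t (ultra_repr e n)).
  rewrite -/(ultra_map (fun n => @vrestr k (G n) t) e) eb.
  apply: filterS3 eE => n eE eb' ex.
  by apply/imsetP; exists (ultra_repr e n); rewrite // inE eE eb' eqxx.
move=> xb.
pose P n (v : vertices (G n)) :=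
  [&& v \in edges (G n), vrestr t v == ultra_repr b n & vproj t v == ultra_repr x n].
pose e n := odflt (neFin_point (vertices (G n))) [pick v | P n v].
have eP : \forall n \near U, P n (e n).
  apply: filterS xb => n /imsetP[v]; rewrite inE => /andP[vE vb] xv.
  by rewrite /e; case: pickP => //= /(_ v); rewrite /P vE vb xv eqxx.
exists (ultra_class UU e).
  split; first by apply/internal_class; apply: filterS eP => n /and3P[].
  rewrite /= -[RHS]ultra_classK; apply: ultra_class_eq.
  have := ultra_reprK UU e; apply: filterS2 eP => n /and3P[_ /eqP <- _] ->.
  by [].
rewrite -[RHS]ultra_classK; apply: ultra_class_eq.
have := ultra_reprK UU e; apply: filterS2 eP => n /and3P[_ _ /eqP <-] ->.
by [].
Qed.

Variables (mu : probability (upart UU G t) R) (nu : probability (ucoprod UU G t) R).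
Hypotheses (mu_loeb : is_loeb_measure mu) (nu_loeb : is_loeb_measure nu).

Lemma perfect_disagreement (A : set (upart UU G t)) (B : forall n, {set X n}) (s : R) :
  perfect mu nu A -> 0 < s -> (mu (internal_set B `\` A) <= s%:E)%E ->
  \forall n \near U, exists m : pred (Y n),
    (disagreement (@in_fiber k (G n) t) (B n) m)%:R <= (3 * s) * (#|X n|%:R * #|Y n|%:R).
Proof.
move=> [mA [N [mN N0 goodN]]] s0 BA.
(* The [y] whose fiber cuts [B n] into two large pieces. For almost every [b] one piece of [A] is
   null, so the corresponding piece of [B] has measure at most [s]. The threshold [2 * s] leaves
   room for a strict inequality, which passes to [U]-many [n]; hence the internal set of bad points
   lies in a null set. *)
pose Bad n := [set y : Y n |
  (2 * s * #|X n|%:R < #|[set x in B n | in_fiber x y]%SET|%:R) &&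
  (2 * s * #|X n|%:R < #|[set x in B n | ~~ in_fiber x y]%SET|%:R)]%SET.
have mB := measurable_internal B.
have BadN : internal_set Bad `<=` N.
  move=> b bBad; apply: goodN => good_b.
  have mF : measurable (ufiber b) by rewrite ufiberE; exact: measurable_internal.
  have s2 : (s%:E < (2 * s)%:E)%E by rewrite lte_fin; lra.
  apply: (@filter_not_empty _ U).
  case: good_b => A0.
  - have : (mu (internal_set B `&` ufiber b) < (2 * s)%:E)%E.
      apply: le_lt_trans s2; apply: le_trans BA; rewrite -[leRHS]add0e -A0.
      apply: le_measureU2; try exact: measurableI; first exact: measurableD.
      by move=> z [zB zf]; have [zA|nA] := pselect (A z); [left|right].
    rewrite ufiberE internal_setI => /(loeb_freq_lt mu_loeb); apply: filterS2 bBad => n.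
    rewrite inE => /andP[+ _] h2.
    have -> : [set x in B n | in_fiber x (ultra_repr b n)]%SET =
        (B n :&: fiber (ultra_repr b n))%SET by apply/setP => x; rewrite !inE.
    by move=> /(lt_trans h2); rewrite ltxx.
  - have : (mu (internal_set B `\` ufiber b) < (2 * s)%:E)%E.
      apply: le_lt_trans s2; apply: le_trans BA; rewrite -[leRHS]add0e -A0.
      apply: le_measureU2; try exact: measurableD.
      by move=> z [zB zf]; have [zA|nA] := pselect (A z); [left|right].
    rewrite ufiberE internal_setD => /(loeb_freq_lt mu_loeb); apply: filterS2 bBad => n.
    rewrite inE => /andP[_ +] h2.
    have -> : [set x in B n | ~~ in_fiber x (ultra_repr b n)]%SET =
        (B n :\: fiber (ultra_repr b n))%SET by apply/setP => x; rewrite !inE andbC.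
    by move=> /(lt_trans h2); rewrite ltxx.
have : (nu (internal_set Bad) < s%:E)%E.
  apply: (@le_lt_trans _ _ (nu N)); last by rewrite N0 lte_fin.
  by apply: le_measure; rewrite ?inE //; exact: measurable_internal.
move=> /(loeb_freq_lt nu_loeb); apply: filterS => n /ltW Badn.
have s20 : 0 <= 2 * s by rewrite mulr_ge0 // ltW.
have [m mP] := majority_disagreement s20 Badn.
by exists m; apply: le_trans mP _; rewrite (_ : 2 * s + s = 3 * s) //; ring.
Qed.

Lemma le_measure_bigsetU (I : finType) (F : I -> set (upart UU G t)) (r : I -> \bar R) :
  (forall i, measurable (F i)) -> (forall i, (mu (F i) <= r i)%E) ->
  measurable (\big[setU/set0]_i F i) /\ (mu (\big[setU/set0]_i F i) <= \sum_i r i)%E.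
Proof.
move=> mF Fr.
elim/big_ind2 : _ => [|X1 r1 X2 r2 [m1 h1] [m2 h2]|i _]; last by [].
  by rewrite measure0.
split; first exact: measurableU.
by apply: le_trans (leeD h1 h2); apply: le_measureU2 => //; exact: measurableU.
Qed.

(* Null parts can be replaced by a part of positive measure, as parts are not *)
(* required to be distinct here.                                              *)
Lemma positive_decomposition (eps : R) : 0 <= eps ->
  perfect_decomposition mu nu measurable eps ->
  exists (n : nat) (A : 'I_n.+1 -> set (upart UU G t)),
    [/\ forall i, perfect mu nu (A i), forall i, (0 < mu (A i))%E &
        (mu (~` (\bigcup_i A i)) <= eps%:E * mu (A ord0))%E].
Proof.
move=> eps0 [n [A [mA pA _ Aeps]]].
(* If the first part is null, the hypothesis says that the union has full measure, and any part of
   positive measure can take its place. *)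
have [j0 [j0_gt0 Aj0]] : exists j0, (0 < mu (A j0))%E /\
    (1 - eps%:E * mu (A j0) <= mu (\bigcup_i A i))%E.
  have [A0|A0] := eqVneq (mu (A ord0)) 0%E; last first.
    by exists ord0; split => //; rewrite lt0e A0 measure_ge0.
  move: Aeps; rewrite A0 mule0 sube0 => A1.
  have mUA : measurable (\bigcup_i A i) by apply: fin_bigcup_measurable.
  have [j Aj] : exists j, (0 < mu (A j))%E.
    apply: contrapT => /forallNP An; move: A1; apply/negP; rewrite -ltNge.
    apply: (@le_lt_trans _ _ 0%E); last by rewrite lte_fin.
    have An0 i : (mu (A i) <= 0)%E by rewrite leNgt; exact/negP/An.
    have [mU U0] := @le_measure_bigsetU _ A (fun=> 0%E) mA An0.
    rewrite [leRHS]big1 in U0 => //; apply: le_trans U0; apply: le_measure; rewrite ?inE //.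
    by rewrite -bigcup_seq => z [i _ zi]; exists i => //=; exact: mem_index_enum.
  exists j; split => //; apply: le_trans A1.
  rewrite leeBlDr ?leeDl ?mule_ge0 ?measure_ge0 ?lee_fin //.
  by rewrite fin_numM // fin_num_measure.
have mUA : measurable (\bigcup_i A i) by apply: fin_bigcup_measurable.
(* The extra index puts [A j0] in first position; the old parts follow, with the null ones
   overwritten by [A j0]. *)
pose A' (i : 'I_n.+2) := if unlift ord0 i is Some j then
  if mu (A j) == 0%E then A j0 else A j else A j0.
pose N i := if mu (A i) == 0%E then A i else set0.
have A'N : ~` (\bigcup_i A' i) `<=` ~` (\bigcup_i A i) `|` \big[setU/set0]_i N i.
  move=> z nz; have [[i _ zi]|] := pselect ((\bigcup_i A i) z); last by left.
  right; rewrite -bigcup_seq; exists i; first exact: mem_index_enum.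
  rewrite /N; case: eqP => // /eqP Ai; apply: nz; exists (lift ord0 i) => //.
  by rewrite /A' liftK (negPf Ai).
have pA' i : perfect mu nu (A' i).
  by rewrite /A'; case: unlift => // j; case: ifP.
have [mN N0] : measurable (\big[setU/set0]_i N i) /\
    (mu (\big[setU/set0]_i N i) <= \sum_(i < n.+1) 0)%E.
  apply: le_measure_bigsetU => i; rewrite /N; case: ifP => //; first by move/eqP ->.
  by rewrite measure0.
exists n.+1, A'; split => // [i|].
  rewrite /A'; case: unlift => // j; case: eqP => // /eqP Aj.
  by rewrite lt0e Aj measure_ge0.
have -> : A' ord0 = A j0 by rewrite /A' unlift_none.
apply: (@le_trans _ _ (mu (~` (\bigcup_i A i)) + mu (\big[setU/set0]_i N i))%E).
  apply: le_measureU2 => //; apply: measurableC => //.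
  by apply: fin_bigcup_measurable => // i _; have [] := pA' i.
rewrite [leRHS]big1 in N0 => //; rewrite -[leRHS]adde0; apply: leeD => //.
rewrite probability_setC // leeBlDr ?fin_num_measure // addeC -leeBlDr //.
by rewrite fin_numM // fin_num_measure.
Qed.

(** The quantifier order is the point: [p] and [c] are chosen before [eta], so that [eta] may later
    depend on them through [f]. The factor 2 in front of [eps] absorbs the approximation error. *)
Lemma internal_decomposition (eps : R) : 0 < eps ->
  perfect_decomposition mu nu measurable eps ->
  exists (p : nat) (c : R), 0 < c /\ forall eta : R, 0 < eta ->
  exists B : 'I_p.+1 -> forall n, {set X n}, \forall n \near U,
    [/\ forall j, c * #|X n|%:R <= #|B j n|%:R,
        #|~: (\bigcup_j B j n)%SET|%:R <= 2 * eps * #|B ord0 n|%:R &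
        forall j, exists m : pred (Y n), (disagreement (@in_fiber k (G n) t) (B j n) m)%:R
          <= eta * (#|X n|%:R * #|Y n|%:R)].
Proof.
move=> eps0 /(positive_decomposition (ltW eps0))[p [A [pA A_gt0 Aeps]]].
have mA i : measurable (A i) by have [] := pA i.
pose a i := fine (mu (A i)).
have aE i : mu (A i) = (a i)%:E by rewrite fineK // fin_num_measure.
have a_gt0 i : 0 < a i by rewrite -lte_fin -aE.
pose c := \big[Order.min/1]_i a i.
have c0 : 0 < c by rewrite lt_bigmin // ltr01 => i _.
have ca i : c <= a i by exact: bigmin_le.
exists p, (c / 2); split=> [|eta eta0]; first by rewrite divr_gt0.
pose d : R := p.+2%:R + 4 * eps.
have d0 : 0 < d by rewrite addr_gt0 ?mulr_gt0.
(* The first bound keeps each frequency above [a j - 2 * s >= c / 2]. The second matches the [3 * s]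
   of [perfect_disagreement]. The third is the inequality [eps * a ord0 + p.+2%:R * s <= 2 * eps *
   (a ord0 - 2 * s)], where [p.+2] exceeds the number of parts by one to leave strict room. *)
pose s := Order.min (Order.min (c / 4) (eta / 3)) (eps * a ord0 / d).
have s0 : 0 < s by rewrite !lt_min !divr_gt0 // mulr_gt0.
have [sc seta sa] : [/\ s <= c / 4, s <= eta / 3 & s <= eps * a ord0 / d].
  by split; rewrite /s !ge_min lexx ?orbT.
have /choice[B BP] : forall j, exists B, (mu (A j `\` internal_set B) <= s%:E)%E /\
    (mu (internal_set B `\` A j) <= s%:E)%E.
  by move=> j; have [_ /(_ _ s0)] := @measurable_approximable _ _ _ _ mu _ (mA j).
exists B.
have mB j := @measurable_internal U UU _ (B j).
have Bgt j : \forall n \near U, (a j - 2 * s) * #|X n|%:R < #|B j n|%:R.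
  apply: (loeb_freq_gt mu_loeb); apply: (@lt_le_trans _ _ (a j - s)%:E).
    by rewrite lte_fin; lra.
  rewrite EFinB leeBlDr // -aE.
  apply: (@le_trans _ _ (mu (internal_set (B j)) + mu (A j `\` internal_set (B j)))%E).
    apply: le_measureU2 => //; first exact: measurableD.
    by move=> z zA; have [zB|nB] := pselect (internal_set (B j) z); [left|right].
  by apply: leeD => //; have [] := BP j.
have Blt : \forall n \near U, #|~: (\bigcup_j B j n)%SET|%:R <
    (eps * a ord0 + p.+2%:R * s) * #|X n|%:R.
  apply: (loeb_freq_lt mu_loeb (A := fun n => ~: (\bigcup_j B j n)%SET)).
  have [mU hU] := le_measure_bigsetU (fun j => measurableD (mA j) (mB j)) (fun j => (BP j).1).
  apply: (@le_lt_trans _ _ (mu (~` (\bigcup_i A i)) +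
      mu (\big[setU/set0]_i (A i `\` internal_set (B i))))%E).
    apply: le_measureU2 => //.
    - by apply: measurableC; apply: fin_bigcup_measurable.
    - exact: measurable_internal.
    - move=> z zB; have [[i _ zA]|] := pselect ((\bigcup_i A i) z); last by left.
      right; rewrite -bigcup_seq; exists i; first exact: mem_index_enum.
      split => // zBi; apply: (@filter_not_empty _ U).
      apply: filterS2 zB zBi => n; rewrite finset.in_setC => /negP nB Bi; apply: nB.
      by apply/finset.bigcupP; exists i.
  apply: (le_lt_trans (leeD Aeps hU)).
  rewrite sumEFin sumr_const card_ord -[s *+ _]mulr_natl aE -EFinM -EFinD lte_fin ltrD2l.
  by rewrite ltr_pM2r // ltr_nat.
have Bdis : \forall n \near U, forall j, exists m : pred (Y n),
    (disagreement (@in_fiber k (G n) t) (B j n) m)%:R <= (3 * s) * (#|X n|%:R * #|Y n|%:R).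
  apply: filter_forall => j; apply: (perfect_disagreement (pA j) s0); exact: (BP j).2.
have Bgt' : \forall n \near U, forall j, (a j - 2 * s) * #|X n|%:R < #|B j n|%:R.
  by apply: filter_forall.
apply: filterS3 Bgt' Blt Bdis => n Bgtn Bltn Bdisn; split.
- move=> j; apply: le_trans (ltW (Bgtn j)); rewrite ler_wpM2r //.
  by have := ca j; lra.
- apply: le_trans (ltW Bltn) _.
  apply: (@le_trans _ _ (2 * eps * ((a ord0 - 2 * s) * #|X n|%:R))).
    rewrite mulrA ler_wpM2r //; move: sa; rewrite ler_pdivlMr // /d; lra.
  by rewrite ler_wpM2l ?mulr_ge0 // ltW.
- move=> j; have [m mP] := Bdisn j; exists m; apply: le_trans mP _.
  by rewrite ler_wpM2r ?mulr_ge0 //; lra.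
Qed.

End Fibers.

(** * Regular partitions *)

Section FirstCopies.
Variables (T : finType) (D : nat -> {set T}).

(** Turns a family whose members are pairwise equal or disjoint into a disjoint family with the same
    union, by emptying repetitions. *)
Definition first_copy i : {set T} :=
  if [exists j : 'I_i, D j == D i] then finset.set0 else D i.

Lemma first_copyP i : first_copy i = finset.set0 \/ first_copy i = D i.
Proof. by rewrite /first_copy; case: ifP; [left|right]. Qed.

Lemma mem_first_copy x i : x \in D i -> exists2 j, (j <= i)%N & x \in first_copy j.
Proof.
elim/ltn_ind: i => i IH xi.
have [/existsP[j /eqP ji]|ne] := boolP [exists j : 'I_i, D j == D i].
  rewrite -ji in xi; have [l lj xl] := IH j (ltn_ord j) xi.
  by exists l => //; apply: leq_trans lj (ltnW _).
by exists i => //; rewrite /first_copy (negPf ne).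
Qed.

Lemma first_copy_disjoint i j :
  (forall i j, D i = D j \/ [disjoint D i & D j]%B) -> i != j ->
  [disjoint first_copy i & first_copy j]%B.
Proof.
move=> Ddisj; wlog ij : i j / (i < j)%N => [hw|_].
  rewrite neq_ltn => /orP[] h; [|rewrite disjoint_sym]; apply: hw => //.
    by rewrite ltn_eqF.
  by rewrite ltn_eqF.
rewrite /first_copy; case: ifP => _; first by rewrite -setI_eq0 finset.set0I.
case: ifP => [_|/negbT]; first by rewrite -setI_eq0 finset.setI0.
by rewrite negb_exists => /forallP/(_ (Ordinal ij))/= /eqP; case: (Ddisj i j).
Qed.

End FirstCopies.

(** For a fixed sample, [predicted] is the class of points with one given trace on the sample, and
    it depends on [m] only through that trace. *)
Lemma predicted_disjoint (X Y : finType) (E : X -> Y -> bool) M (m1 m2 : pred Y)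
    (s : {ffun 'I_M -> Y}) :
  predicted E m1 s = predicted E m2 s \/
  [disjoint predicted E m1 s & predicted E m2 s]%B.
Proof.
have [/forallP m12|] := boolP [forall l, m1 (s l) == m2 (s l)].
  left; apply/setP => x; rewrite !inE.
  by apply: eq_forallb => l; rewrite (eqP (m12 l)).
rewrite negb_forall => /existsP[l ml]; right; rewrite -setI_eq0; apply/eqP/setP => x.
rewrite !inE; apply/negP => /andP[/forallP/(_ l)/eqP e1 /forallP/(_ l)/eqP e2].
by move: ml; rewrite -e1 -e2 eqxx.
Qed.

Section Box.
Variables (R : realType) (k : nat) (G : hypergraph k).

Lemma in_fiber_edge t (v : vertices G) :
  in_fiber (vproj t v) (vrestr t v) = (v \in edges G).
Proof.
apply/imsetP/idP => [[w]|vE]; last by exists v; rewrite // inE vE eqxx.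
rewrite inE => /andP[wE /eqP wv] vw; suff <- : w = v by [].
apply/ffunP => s; have [->|st] := eqVneq s t; first by [].
by have := congr1 (fun y : coprod G t => (y : {dffun _}) (Sub s st)) wv; rewrite !ffunE.
Qed.

Lemma card_part_coprod t :
  (#|{: part G t}| * #|{: coprod G t}|)%N = #|{: vertices G}|.
Proof.
have cardV (I : finType) (T : I -> neFinType) : #|{: neProd T}| = (\prod_i #|{: T i}|)%N.
  rewrite -cardsT -(eq_bigr _ (fun i _ => cardsT (T i))) -cardsXn.
  congr #|pred_of_set _|; apply/setP => v.
  by rewrite !inE; apply/esym/forallP => i; rewrite inE.
rewrite !cardV (bigD1 t) //=; congr muln.
by rewrite -(big_sub (fun s => s != t) (fun s => #|{: part G s}|)) //.
Qed.

(** If the density were between delta and 1 - delta, both the edges and the non-edges in the box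
    would number at least delta |W|. Then [box_homogeneous] gives delta^2 |W| <= 2 k tau |V|, while
    |W| >= c^k |V|, against the smallness of [tau]. *)
Lemma box_density (D : forall t, {set part G t}) (m : forall t, pred (coprod G t))
    (c tau delta : R) : 0 < c -> 0 < delta -> 0 <= tau ->
  (forall t, c * #|{: part G t}|%:R <= #|D t|%:R) ->
  (forall t, (disagreement (@in_fiber k G t) (D t) (m t))%:R <=
    tau * (#|{: part G t}|%:R * #|{: coprod G t}|%:R)) ->
  2 * k%:R * tau * c ^- k < delta ^+ 2 ->
  (density R (setXn D) \in `[0, delta[) \/ (density R (setXn D) \in `]1 - delta, 1]).
Proof.
move=> c0 delta0 tau0 Dc Dm small.
set W := setXn D.
pose V : R := #|{: vertices G}|%:R.
have V0 : 0 < V by rewrite ltr0n neFin_gt0.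
pose w : R := #|W|%:R; pose e : R := #|edges G :&: W|%:R.
have wV : c ^+ k * V <= w.
  rewrite /w /W cardsXn /V -cardsT.
  have -> : [set: vertices G]%SET = setXn (fun t => [set: part G t]%SET).
    by apply/setP => v; rewrite !inE; apply/esym/forallP => i; rewrite inE.
  rewrite cardsXn !natr_prod -[k in c ^+ k]card_ord -prodr_const -big_split /=.
  apply: ler_prod => t _; rewrite cardsT Dc andbT mulr_ge0 ?ler0n // ltW //.
have w0 : 0 < w by apply: lt_le_trans wV; rewrite mulr_gt0 // exprn_gt0.
pose N := Num.truncn (tau * V).
have NV : N%:R <= tau * V by rewrite truncn_le // mulr_ge0 // ltW.
(* Errors on the box inject into the errors on [D t] times the whole coproduct, which [Dm]
   counts. *)
have badN t : (#|[set v in W | (v \in edges G) != m t (vrestr t v)]%SET| <= N)%N.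
  rewrite truncn_ge_nat ?mulr_ge0 ?(ltW V0) //.
  rewrite /V -(card_part_coprod t) natrM; apply: le_trans (Dm t); rewrite ler_nat.
  pose h (v : vertices G) := (vproj t v, vrestr t v).
  have h_inj : injective h.
    move=> v v' [vv' /ffunP rvv']; apply/ffunP => s.
    have [->|st] := eqVneq s t; first exact: vv'.
    by have := rvv' (Sub s st); rewrite !ffunE.
  rewrite -(card_imset _ h_inj); apply/subset_leq_card/fintype.subsetP => z.
  case/imsetP => v /finset.setIdP[/setXnP vW vm] ->.
  rewrite inE /= in_fiber_edge vm andbT; exact: vW.
have inv t (x y : {dffun forall t, part G t}) : (forall j, j != t -> x j = y j) ->
    m t (vrestr t x) = m t (vrestr t y).
  move=> xy; congr (m t _); apply/ffunP => s; rewrite !ffunE; exact: xy (valP s).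
have := box_homogeneous inv badN; rewrite card_ord -(ler_nat R) !natrM -/W -/e -/w.
have -> : #|W :\: edges G|%:R = w - e :> R.
  by rewrite /w -(cardsID (edges G) W) natrD finset.setIC addrC addKr.
move=> hom; rewrite /density -/W -/e -/w !in_itv /=.
have e0 : 0 <= e by exact: ler0n.
have ew : e <= w by rewrite ler_nat subset_leq_card // subsetIr.
rewrite divr_ge0 ?(ltW w0) //= ler_pdivrMr // mul1r ew andbT.
have [|de] := ltP (e / w) delta; first by left.
have [|ed] := ltP (1 - delta) (e / w); first by right.
exfalso; move: small; apply/negP; rewrite -leNgt.
have dw : delta * w <= e by rewrite -ler_pdivlMr.
have dw' : delta * w <= w - e.
  by move: ed; rewrite ler_pdivrMr // mulrBl mul1r; lra.
have ck : 0 < c ^+ k by rewrite exprn_gt0.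
rewrite ler_pdivlMr // -(ler_pM2r (mulr_gt0 V0 w0)).
have h1 : delta * w * (delta * w) <= e * (w - e).
  by rewrite ler_pM // mulr_ge0 // ltW.
have h2 : k%:R * (2 * (N%:R * w)) <= k%:R * (2 * ((tau * V) * w)).
  by rewrite !ler_wpM2l // ler_wpM2r // ltW.
have h3 : delta ^+ 2 * c ^+ k * (V * w) <= delta ^+ 2 * w * w.
  rewrite (_ : _ * (V * w) = delta ^+ 2 * w * (c ^+ k * V)); last by ring.
  by rewrite ler_pM2l // mulr_gt0 // exprn_gt0.
have -> : 2 * k%:R * tau * (V * w) = k%:R * (2 * (tau * V * w)) by ring.
apply: (le_trans h3); apply: le_trans h2; apply: le_trans hom; apply: le_trans h1.
by rewrite le_eqVlt; apply/orP; left; apply/eqP; ring.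
Qed.

Lemma fiber_intersection_predicted t M (m : pred (coprod G t)) (s : {ffun 'I_M -> coprod G t}) :
  fiber_intersection M (predicted (@in_fiber k G t) m s).
Proof.
pose F l : {set part G t} := if m (s l) then fiber (s l) else (~: fiber (s l))%SET.
exists [seq F l | l <- enum 'I_M]; split.
- by rewrite size_map -cardE card_ord.
- move=> _ /mapP[l _ ->]; exists (s l); rewrite /F; by case: ifP; [left|right].
- rewrite big_map big_enum /=; apply/setP => x; rewrite inE.
  apply/forallP/finset.bigcapP => /= h l; have := h l; rewrite /in_fiber /F.
    by move=> /eqP <-; case: ifP => [//|/negbT]; rewrite finset.in_setC.
  by move=> /(_ isT); case: ifP => [_ ->|_]; rewrite // finset.in_setC => /negPf ->.
Qed.

(** Empty parts occur as padding and as emptied repetitions; a fiber and its complement express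
    them, whence the [maxn 2 M] below. *)
Lemma fiber_intersection_set0 t : fiber_intersection 2 (finset.set0 : {set part G t}).
Proof.
pose b := neFin_point (coprod G t).
exists [:: fiber b; ~: fiber b]%SET; split => //.
  by move=> C; rewrite !inE => /orP[] /eqP ->; exists b; [left|right].
by rewrite !big_cons big_nil finset.setIT finset.setICr.
Qed.

Lemma fiber_intersectionW t M N (C : {set part G t}) : (M <= N)%N ->
  fiber_intersection M C -> fiber_intersection N C.
Proof. by move=> MN [s [sM sF ->]]; exists s; split => //; exact: leq_trans MN. Qed.

Lemma leq_card_bigcup (I T : finType) (F : I -> {set T}) :
  (#|(\bigcup_i F i)%SET| <= \sum_i #|F i|)%N.
Proof.
elim/big_ind2 : _ => [|A1 n1 A2 n2 h1 h2|//]; first by rewrite cards0.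
by apply: leq_trans (leq_card_setU _ _) _; exact: leq_add.
Qed.

Lemma regular_partition_of_decomposition (eps c tau eta : R) (f : nat -> R) (M N' : nat)
    (p : 'I_k -> nat) (B : forall t, 'I_(p t).+1 -> {set part G t})
    (m : forall t, 'I_(p t).+1 -> pred (coprod G t)) :
  0 < eps -> 0 < c -> 0 <= tau -> 0 < f N' -> (1 < N')%N ->
  (forall t, (p t).+1 < N')%N ->
  (forall t, (p t).+1%:R * (M%:R * eta + M.+1%:R^-1) <= tau) ->
  (forall t, ((p t).+1%:R + eps / 2) * tau <= eps * c / 4) ->
  tau <= c / 2 ->
  2 * k%:R * tau * (c / 2) ^- k < f N' ^+ 2 ->
  (forall t j, c * #|{: part G t}|%:R <= #|B t j|%:R) ->
  (forall t, #|~: (\bigcup_j B t j)%SET|%:R <= eps / 2 * #|B t ord0|%:R) ->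
  (forall t j, (disagreement (@in_fiber k G t) (B t j) (m t j))%:R <=
     eta * (#|{: part G t}|%:R * #|{: coprod G t}|%:R)) ->
  exists A : forall t, nat -> {set part G t}, regular_partition eps f N' A /\
    forall t i, (0 < i < N')%N -> fiber_intersection (maxn 2 M) (A t i).
Proof.
move=> eps0 c0 tau0 f0 N'1 pN' tauM tau_eps tau_c tau_f Bc B_eps Bm.
have X0 t : 0 < #|{: part G t}|%:R :> R by rewrite ltr0n neFin_gt0.
have Y0 t : (0 < #|{: coprod G t}|)%N by exact: neFin_gt0.
have /all_sig[s sP] t : {s : {ffun 'I_M -> coprod G t} | forall j : 'I_(p t).+1,
    #|B t j :\: predicted (@in_fiber k G t) (m t j) s|%:R <= tau * #|{: part G t}|%:R /\
    (disagreement (@in_fiber k G t) (predicted (@in_fiber k G t) (m t j) s) (m t j))%:R <=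
      tau * (#|{: part G t}|%:R * #|{: coprod G t}|%:R)}.
  apply: cid; have [s sP] := @sampling R _ _ _ (Y0 t) _ _ _ _ M (Bm t); exists s => j.
  have [h1 h2] := sP j; split; [apply: (le_trans h1)|apply: (le_trans h2)].
    by rewrite ler_wpM2r.
  by rewrite ler_wpM2r // mulr_ge0.
pose D t j := predicted (@in_fiber k G t) (m t j) (s t).
(* All [t] must share the same [N'] although [p t] varies, so the shorter families are padded with
   empty sets. *)
pose Dn t i : {set part G t} := if (i < (p t).+1)%N then D t (inord i) else finset.set0.
have DnE t (j : 'I_(p t).+1) : Dn t j = D t j by rewrite /Dn ltn_ord inord_val.
have Dn_disj t i j : Dn t i = Dn t j \/ [disjoint Dn t i & Dn t j]%B.
  rewrite /Dn; case: ifP => _; last by right; rewrite -setI_eq0 finset.set0I.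
  case: ifP => _; last by right; rewrite -setI_eq0 finset.setI0.
  exact: predicted_disjoint.
have Dc t j : c / 2 * #|{: part G t}|%:R <= #|D t j|%:R.
  have h1 := (sP t j).1; have h2 := Bc t j.
  have h3 : #|B t j|%:R <= #|D t j|%:R + #|B t j :\: D t j|%:R :> R.
    rewrite -natrD ler_nat -(cardsID (D t j) (B t j)) leq_add2r subset_leq_card //.
    exact: subsetIr.
  have h4 := ler_wpM2r (ltW (X0 t)) tau_c; rewrite -/(D t j) in h1; lra.
pose A t i := if i is i'.+1 then first_copy (Dn t) i' else (~: \bigcup_j D t j)%SET.
exists A; split.
  split => //.
  - move=> t x; have [|xD] := boolP (x \in \bigcup_j D t j)%SET.
      case/finset.bigcupP => j _; rewrite -DnE => /mem_first_copy[i ij xi].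
      exists i.+1 => //; apply: leq_ltn_trans (pN' t); rewrite ltnS.
      exact: leq_ltn_trans ij (ltn_ord j).
    by exists 0%N; rewrite ?(ltn_trans _ N'1) //= finset.in_setC.
  - have A0 t i : (0 < i)%N -> [disjoint A t 0%N & A t i]%B.
      case: i => // i _; rewrite disjoint_sym /=; case: (first_copyP (Dn t) i) => ->.
        by rewrite -setI_eq0 finset.set0I.
      rewrite /Dn; case: ifP => _; last by rewrite -setI_eq0 finset.set0I.
      by rewrite finset.disjoints_subset finset.setCK finset.bigcup_sup.
    move=> t [|i] [|j] _ _ // ij; first exact: A0.
      by rewrite disjoint_sym; exact: A0.
    exact: first_copy_disjoint.
  - move=> t /=; have -> : first_copy (Dn t) 0 = D t ord0.
      rewrite /first_copy; case: ifP => [/existsP[[]]//|_].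
      exact: (DnE t ord0).
    (* Passing from [B] to [D] adds at most [(p t).+1%:R * tau] to the uncovered fraction, and
       [B t ord0] exceeds [D t ord0] by at most a fraction [tau]. By [tau_eps] and [Dc] the total
       extra cost is at most [eps / 2 * #|D t ord0|], the half of the budget that [B_eps] leaves. *)
    have hB := B_eps t; have h1 := (sP t ord0).1; rewrite -/(D t ord0) in h1.
    have h3 : #|B t ord0|%:R <= #|D t ord0|%:R + #|B t ord0 :\: D t ord0|%:R :> R.
      rewrite -natrD ler_nat -(cardsID (D t ord0) (B t ord0)) leq_add2r subset_leq_card //.
      exact: subsetIr.
    have h4 : #|~: (\bigcup_j D t j)%SET|%:R <=
        #|~: (\bigcup_j B t j)%SET|%:R + (p t).+1%:R * (tau * #|{: part G t}|%:R) :> R.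
      apply: (@le_trans _ _ (#|~: (\bigcup_j B t j)%SET|%:R + \sum_j #|B t j :\: D t j|%:R)).
        rewrite -natr_sum -natrD ler_nat; apply: leq_trans (leq_add (leqnn _) (leq_card_bigcup _)).
        apply: leq_trans (leq_card_setU _ _); apply/subset_leq_card/fintype.subsetP => x.
        rewrite finset.in_setU !finset.in_setC => xD; rewrite -implyNb negbK; apply/implyP.
        case/finset.bigcupP => j _ xB; apply/finset.bigcupP; exists j => //.
        rewrite finset.in_setD xB andbT; apply: contra xD => xj.
        by apply/finset.bigcupP; exists j.
      rewrite lerD2l -[(p t).+1 in leRHS]card_ord mulr_natl -sumr_const.
      by apply: ler_sum => j _; exact: (sP t j).1.
    have h5 := Dc t ord0; have h6 := ler_wpM2r (ltW (X0 t)) (tau_eps t).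
    have h7 := ler_wpM2l (ltW eps0) h3; have h8 := ler_wpM2l (ltW eps0) h1.
    have h9 := ler_wpM2l (ltW eps0) h5; lra.
  - move=> i iN' C C0.
    (* A nonempty box has no empty side, so each side is a genuine [D t j] rather than padding or an
       emptied repetition. *)
    have iP t : exists j : 'I_(p t).+1, A t (i t) = D t j.
      have /finset.set0Pn[v /setXnP/(_ t)] := C0.
      have := iN' t; case: (i t) => // i' _ /=.
      case: (first_copyP (Dn t) i') => ->; first by rewrite inE.
      by rewrite /Dn; case: ifP => _; [exists (inord i')|rewrite inE].
    have /all_sig[j jP] t : {j | A t (i t) = D t j} by exact: cid.
    have -> : C = setXn (fun t => D t (j t)) by apply: eq_setXn.
    apply: (@box_density _ (fun t => m t (j t)) (c / 2) tau); rewrite ?divr_gt0 // => t.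
    exact: (sP t (j t)).2.
move=> t [//|i] _ /=; case: (first_copyP (Dn t) i) => ->.
  apply: (fiber_intersectionW (leq_maxl _ _)); exact: fiber_intersection_set0.
rewrite /Dn; case: ifP => _.
  apply: (fiber_intersectionW (leq_maxr _ _)); exact: fiber_intersection_predicted.
apply: (fiber_intersectionW (leq_maxl _ _)); exact: fiber_intersection_set0.
Qed.

End Box.

(** * Choice of constants and the compactness argument *)

Lemma regularity_constants (R : realType) (k N' : nat) (eps c delta : R) :
  0 < eps -> 0 < c -> 0 < delta -> (0 < N')%N ->
  exists (tau eta : R) (M : nat), [/\ 0 < tau, 0 < eta,
    forall q, (q <= N')%N -> q%:R * (M%:R * eta + M.+1%:R^-1) <= tau,
    forall q, (q <= N')%N -> (q%:R + eps / 2) * tau <= eps * c / 4 &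
    tau <= c / 2 /\ 2 * k%:R * tau * (c / 2) ^- k < delta ^+ 2].
Proof.
move=> eps0 c0 delta0 N'0.
have N'0' : 0 < N'%:R :> R by rewrite ltr0n.
pose d := N'%:R + eps / 2; have d0 : 0 < d by rewrite addr_gt0 // divr_gt0.
have c2 : 0 < (c / 2) ^+ k by rewrite exprn_gt0 // divr_gt0.
(* The constants are chosen in the order [tau], [M], [eta]: [M] makes [N'%:R / M.+1%:R] at most
   [tau / 2], and then [eta] does the same for [N'%:R * (M%:R * eta)]. The denominator
   [2 * k%:R + 1] makes the last inequality strict and covers [k = 0]. *)
pose tau := Order.min (Order.min (c / 2) (eps * c / 4 / d))
                (delta ^+ 2 * (c / 2) ^+ k / (2 * k%:R + 1)).
have k0 : 0 < 2 * k%:R + 1 :> R by rewrite ltr_wpDl // mulr_ge0.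
have tau0 : 0 < tau.
  by rewrite !lt_min !divr_gt0 // ?mulr_gt0 // exprn_gt0.
have [tau1 tau2 tau3] : [/\ tau <= c / 2, tau <= eps * c / 4 / d &
    tau <= delta ^+ 2 * (c / 2) ^+ k / (2 * k%:R + 1)].
  by split; rewrite /tau !ge_min lexx ?orbT.
pose M := Num.truncn (2 * N'%:R / tau).
pose eta := tau / (2 * N'%:R * M.+1%:R).
have M0 : 0 < M.+1%:R :> R by rewrite ltr0n.
have eta0 : 0 < eta by rewrite divr_gt0 // !mulr_gt0.
have Mtau : N'%:R / M.+1%:R <= tau / 2.
  rewrite ler_pdivrMr // -ler_pdivrMl ?divr_gt0 //.
  have -> : (tau / 2)^-1 * N'%:R = 2 * N'%:R / tau by field; rewrite gt_eqF.
  by apply/ltW; exact: truncnS_gt.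
have Meta : N'%:R * (M%:R * eta) <= tau / 2.
  rewrite (_ : tau / 2 = N'%:R * (M.+1%:R * eta)).
    by rewrite ler_pM2l // ler_pM2r // ler_nat.
  by rewrite /eta; field; rewrite !gt_eqF.
exists tau, eta, M; split => // [q qN|q qN|].
- apply: (@le_trans _ _ (N'%:R * (M%:R * eta + M.+1%:R^-1))).
    by rewrite ler_wpM2r ?ler_nat // addr_ge0 ?invr_ge0 ?mulr_ge0 // ltW.
  by rewrite mulrDr [leRHS]splitr lerD.
- apply: (@le_trans _ _ (d * tau)).
    by rewrite ler_wpM2r ?(ltW tau0) // lerD2r ler_nat.
  by rewrite mulrC -ler_pdivlMr.
- split => //; rewrite ltr_pdivrMr //; move: tau3; rewrite ler_pdivlMr //.
  by rewrite mulrDr mulr1; move: tau0; lra.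
Qed.

Lemma ultraproducts_perfect_definable (R : realType) (k : nat) (H : hypergraph k -> Prop) :
  ultraproducts_perfect R H (fun U UU G t => measurable) ->
  definable_strong_stable_regularity R H.
Proof.
move=> HH eps f eps0 f01; apply: contrapT => /forallNP noN.
have /choice[G GP] : forall N, exists G, H G /\ forall N' (A : forall t, nat -> {set part G t}),
    ~ [/\ (N' <= N)%N, regular_partition eps f N' A &
      forall i t, (0 < t < N')%N -> fiber_intersection N (A i t)].
  move=> N; have /existsNP[G0 /not_implyP[HG nG]] := noN N; exists G0; split => // N' A h.
  by apply: nG; exists N', A.
(* Extending the cofinite filter makes [U] free: saturation requires this, and so does finding
   arbitrarily large indices at the end. *)
have [U [UU Uoo]] := @ultraFilterLemma nat \oo _.
have /all_sig[mu muP] t : {mu : probability (upart UU G t) R | is_loeb_measure mu}.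
  exact: cid (@loeb_measure_exists R U UU (fun n => part (G n) t) Uoo).
have /all_sig[nu nuP] t : {nu : probability (ucoprod UU G t) R | is_loeb_measure nu}.
  exact: cid (@loeb_measure_exists R U UU (fun n => coprod (G n) t) Uoo).
have eps4 : 0 < eps / 4 by rewrite divr_gt0.
have dec t := internal_decomposition (muP t) (nuP t) eps4
  (HH G U UU mu nu (fun n => (GP n).1) muP nuP _ eps4 t).
have /choice[p /choice[ct ctP]] := dec.
pose c := \big[Order.min/1]_t ct t.
have c0 : 0 < c by rewrite lt_bigmin // => t _; have [] := ctP t.
have cle t : c <= ct t by exact: bigmin_le.
(* Room for the [(p t).+1] sets and the exceptional part, for every [t]. The final [+ 2] gives
   [1 < N'] even when [k = 0]. *)
pose N' := (\max_t (p t).+2 + 2)%N.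
have pN' t : ((p t).+2 <= N')%N.
  by apply: leq_trans (leq_addr _ _); exact: (@leq_bigmax _ (fun t => (p t).+2)).
have /andP[fN'0 _] := f01 N'.
have N'0 : (0 < N')%N by rewrite /N' addn2.
have [tau [eta [M [tau0 eta0 tauM tau_eps [tau_c tau_f]]]]] :=
  regularity_constants k eps0 c0 fN'0 N'0.
have /all_sig[B BP] t := cid ((ctP t).2 eta eta0).
have FU : Filter U by exact: _.
have BP' := filter_forall FU BP.
(* [G n] was chosen to defeat the bound [n]; once [n] exceeds the number of parts and the number of
   fibers used, the partition built in [G n] contradicts that choice. *)
have large : \forall n \near U, (maxn N' (maxn 2 M) <= n)%N.
  by apply: Uoo; exists (maxn N' (maxn 2 M)).
have [n [Bn]] := filter_ex (filterI BP' large).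
rewrite /= !geq_max => /and3P[N'n n2 Mn].
have /all_sig[m mP] t : { m : 'I_(p t).+1 -> pred (coprod (G n) t) |
    forall j, (disagreement (@in_fiber k (G n) t) (B t j n) (m j))%:R
    <= eta * (#|{: part (G n) t}|%:R * #|{: coprod (G n) t}|%:R)}.
  by apply: cid; have [_ _ h] := Bn t; have [m mP] := choice h; exists m.
have [|||||||||A [A1 A2]] := @regular_partition_of_decomposition R k (G n)
  eps c tau eta f M N' p (fun t j => B t j n) m eps0 c0 (ltW tau0) fN'0.
- by rewrite /N' addn2.
- by move=> t; exact: pN'.
- by move=> t; apply: tauM; exact: ltnW (pN' t).
- by move=> t; apply: tau_eps; exact: ltnW (pN' t).
- exact: tau_c.
- exact: tau_f.
- move=> t j; have [h _ _] := Bn t; apply: le_trans (h j); by rewrite ler_wpM2r.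
- move=> t; have [_ h _] := Bn t; apply: (le_trans h).
  by rewrite (_ : 2 * (eps / 4) = eps / 2) //; field.
- exact: mP.
apply: ((GP n).2 N' A); split => // t i ti.
apply: (fiber_intersectionW _ (A2 t i ti)); by rewrite geq_max n2.
Qed.

Theorem proposition4p13 (R : realType) (k : nat) (H : hypergraph k -> Prop) :
  (ultraproducts_perfect R H (fun U UU G t => measurable) ->
     strong_stable_regularity R H) /\
  (ultraproducts_perfect R H (fun U UU G t => @fiber_sigma_algebra U UU k G t) ->
     definable_strong_stable_regularity R H).
Proof.
split.
  move=> /ultraproducts_perfect_definable HH eps f eps0 f01.
  have [N NP] := HH eps f eps0 f01; exists N => G /NP[N' [A [NN' regA _]]].
  by exists N', A.
move=> HH; apply: ultraproducts_perfect_definable.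
move=> G U UU mu nu HG muP nuP eps eps0 t.
have [n [A [_ pA tA epsA]]] := HH G U UU mu nu HG muP nuP eps eps0 t.
by exists n, A; split => // i; have [] := pA i.
Qed.
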